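(* Let $L\ge1$ and let $K$ be an index set. For each $N\in\mathbb N$ let $\mathbf A_{N,1}=(A_{N,1}^{(k)})_{k\in K},\ldots,\mathbf A_{N,L}=(A_{N,L}^{(k)})_{k\in K}$ be independent families of random matrices in $\mathcal M_N(L^\infty)$, each of which, except possibly one, is permutation invariant. Write $\mathbf A_N=\mathbf A_{N,1}\cup\cdots\cup\mathbf A_{N,L}$. Assume that for any $\ell\in\{1,\ldots,L\}$, any $m\ge1$ and any graph monomials $g_1,\ldots,g_m$ with equal input and output (all edges carrying the first label $\ell$), $$\mathbb E\Big[\prod_{i=1}^m\mathrm{Tr}\big(g_i(\mathbf A_{N,\ell})\big)\Big]=O\big(N^{\sum_{i=1}^m\mathfrak f(g_i)/2}\big)\qquad(N\to\infty),$$ where $\mathfrak f(g_i)\ge2$ is the integer determined from the forest of two-edge connected components of the graph underlying $g_i$, as defined in the context. Then $\mathbf A_{N,1},\ldots,\mathbf A_{N,L}$ are asymptotically free with amalgamation in the operator-valued probability space $(\mathcal A_N,\mathcal B_N,\Delta)$ in the following sense. Let $n\ge2$, let $\ell_1,\ldots,\ell_n\in\{1,\ldots,L\}$ with $\ell_1\ne\ell_2\ne\cdots\ne\ell_n$ (consecutive indices distinct), and let $P_{N,1},\ldots,P_{N,n}\in\mathcal B_N\langle X_k:k\in K\rangle$ be explicitly given by $$P_{N,i}=g_{0,i}(\mathbf A_N)X_{k_i(1)}g_{1,i}(\mathbf A_N)\cdots X_{k_i(d_i)}g_{d_i,i}(\mathbf A_N),$$ where each $g_{j,i}$ is a cactus-type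 monomial, and the $d_i$, $k_i(\cdot)\in K$ and $g_{j,i}$ do not depend on $N$. Then the matrix $$\varepsilon_N:=\Delta\Big[\big(P_{N,1}(\mathbf A_{N,\ell_1})-\Delta P_{N,1}(\mathbf A_{N,\ell_1})\big)\cdots\big(P_{N,n}(\mathbf A_{N,\ell_n})-\Delta P_{N,n}(\mathbf A_{N,\ell_n})\big)\Big]$$ converges to zero in Schatten $p$-norm for all $p\ge1$; namely, for every $p\ge1$, $$\mathbb E\Big[\tfrac1N\mathrm{Tr}\big[(\varepsilon_N\varepsilon_N^* )^p\big]\Big]\underset{N\to\infty}{\longrightarrow}0.$$
   Context: $\Delta$ is the diagonal map $\Delta A=(\delta_{i,j}A(i,j))_{i,j=1}^N$ on $N\times N$ matrices. $\mathcal M_N(L^\infty)$ is the algebra of $N\times N$ matrices of bounded random variables. $\mathcal A_N$ is the smallest unital subalgebra of $\mathcal M_N(L^\infty)$ containing the matrices of $\mathbf A_N$ and closed under $\Delta$, and $\mathcal B_N=\Delta(\mathcal A_N)$. $\mathcal B_N\langle X_k:k\in K\rangle$ is the algebra generated by freely noncommuting indeterminates $(X_k)_{k\in K}$ and $\mathcal B_N$; $P(\mathbf A_{N,\ell})$ denotes substitution of $X_k=A_{N,\ell}^{(k)}$. A graph monomial $g$ is a finite connected directed graph $G=(V,E,v_{in},v_{out})$ (multiple edges and loops allowed) with two roots $v_{in},v_{out}\in V$ (input and output, possibly equal), and edge labels $\ell:E\to\{1,\ldots,L\}$, $k:E\to K$. Its evaluation is the $N\times N$ matrix $$g(\mathbf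 A_N)(i,j)=\sum_{\substack{\phi:V\to[N]\\ \phi(v_{in})=j,\ \phi(v_{out})=i}}\ \prod_{e=(v,w)\in E}A_{N,\ell(e)}^{(k(e))}(\phi(w),\phi(v)),\qquad [N]=\{1,\ldots,N\}.$$ When all edges carry the first label $\ell$ it is written $g(\mathbf A_{N,\ell})$. A connected graph is a cactus if every edge belongs to exactly one simple cycle (a loop is a simple cycle; a single vertex is a cactus); an oriented cactus is a cactus each of whose simple cycles is directed. A cactus-type monomial is a graph monomial whose graph is an oriented cactus and whose input and output are equal. Definition of $\mathfrak f$: a cut edge of a finite graph is an edge whose deletion increases the number of connected components (orientation is ignored). A two-edge connected graph is a connected graph without cut edge; a two-edge connected component is a maximal two-edge connected subgraph. $F(G)$ is the forest whose vertices are the two-edge connected components of $G$ and whose edges are the cut edges of $G$, each linking the two components containing its endpoints. $\mathfrak f(G)$ is the number of leaves of $F(G)$, with the convention that a tree of $F(G)$ consisting of a single vertex counts as having two leaves. $\mathfrak f(g)$ is $\mathfrak f$ of the graph underlying $g$. Independence: for each $N$, the $L$ families are independent. $K$ does not depend on $N$. A family $(A_N^{(k)})_{k\in K}$ is permutation invariant if for every permutation matrix $S$ of size $N$, $(A_N^{(k)})_{k\in K}$ and $(SA_N^{(k)}S^{-1})_{k\in K}$ have the same joint distribution.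
   Formalization: Added assumption: for each family and each k there is k' not depending on N such that A^(k') is almost surely the entrywise conjugate or the adjoint of A^(k) (automatic for real or Hermitian matrices); without it the claim fails, e.g. for all-ones matrices times independent uniform phases. *)

(* Defs.v *)
From HB Require Import structures.
From mathcomp Require Import all_boot all_order all_algebra.
From mathcomp Require Import perm complex.
From mathcomp Require Import all_classical all_reals all_analysis.

Set Implicit Arguments.
Unset Strict Implicit.
Unset Printing Implicit Defensive.

Import Order.TTheory GRing.Theory Num.Theory.
Import numFieldNormedType.Exports.

Local Open Scope classical_set_scope.
Local Open Scope ring_scope.
Local Open Scope complex_scope.
Local Open Scope sesquilinear_scope.

(** * Finite directed multigraphs *)

Record digraph := Digraph {
  vertex : finType;
  edge : finType;
  src : edge -> vertex;
  tgt : edge -> vertex }.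

Section Subgraphs.
Variable G : digraph.

(* A subgraph is a pair of a vertex set and an edge set; orientation is ignored
   throughout this section. *)
Definition subgraph := ({set vertex G} * {set edge G})%type.

Definition is_subgraph (H : subgraph) : bool :=
  [forall e in H.2, (src e \in H.1) && (tgt e \in H.1)].

Definition sub_subgraph (H H' : subgraph) : bool :=
  (H.1 \subset H'.1) && (H.2 \subset H'.2).

Definition whole_graph : subgraph := (finset.setT, finset.setT).

Definition adjacent (F : {set edge G}) : rel (vertex G) := fun x y =>
  [exists e in F, ((src e == x) && (tgt e == y)) ||
                  ((src e == y) && (tgt e == x))].

Definition connected_graph (H : subgraph) : bool :=
  (H.1 != finset.set0) &&
  [forall x in H.1, forall y in H.1, connect (adjacent H.2) x y].

Definition nb_components (H : subgraph) : nat := n_comp (adjacent H.2) H.1.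

Definition cut_edge (H : subgraph) (e : edge G) : bool :=
  (e \in H.2) && (nb_components H < nb_components (H.1, H.2 :\ e)%SET)%N.

Definition two_edge_connected (H : subgraph) : bool :=
  [&& is_subgraph H, connected_graph H & [forall e, ~~ cut_edge H e]].

Definition tec_components : {set subgraph} :=
  [set H | two_edge_connected H &&
     [forall H' : subgraph,
        two_edge_connected H' && sub_subgraph H H' ==> (H' == H)]]%SET.

(* The vertices of the forest F(G) are the elements of [tec_components], and its
   edges are the cut edges e of G, e joining the two components that contain its
   two endpoints; [forest_degree H] is thus the degree of the vertex H in F(G). *)
Definition forest_degree (H : subgraph) : nat :=
  #|[set e | cut_edge whole_graph e &&
             ((src e \in H.1) || (tgt e \in H.1))]%SET|.

(* A vertex of degree 0 is a whole tree of F(G), and counts as two leaves. *)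
Definition leaf_number : nat :=
  (\sum_(H in tec_components)
     match forest_degree H with 0 => 2 | 1 => 1 | _ => 0 end)%N.

(** * Cacti *)

(* A dart is an edge with a direction of travel, [true] being the direction of
   the edge itself. *)
Definition dart := (edge G * bool)%type.
Definition dart_from (d : dart) : vertex G := if d.2 then src d.1 else tgt d.1.
Definition dart_to (d : dart) : vertex G := if d.2 then tgt d.1 else src d.1.

(* A closed walk with pairwise distinct vertices and pairwise distinct edges: a
   loop and a pair of parallel edges qualify, going back and forth along a single
   edge does not. *)
Definition simple_closed_walk (s : seq dart) : bool :=
  [&& s != [::],
      path.cycle (fun d d' => dart_to d == dart_from d') s,
      uniq [seq dart_from d | d <- s] &
      uniq [seq d.1 | d <- s]].

(* A simple cycle is identified with its set of edges, so that it depends neither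
   on the starting point nor on the direction of travel. *)
Definition simple_cycle (C : {set edge G}) : Prop :=
  exists2 s, simple_closed_walk s & C = [set:: [seq d.1 | d <- s]]%SET.

Definition directed_cycle (C : {set edge G}) : Prop :=
  exists2 s, simple_closed_walk s /\ all (fun d : dart => d.2) s
           & C = [set:: [seq d.1 | d <- s]]%SET.

Definition cactus : Prop :=
  connected_graph whole_graph /\
  forall e : edge G, exists! C : {set edge G}, simple_cycle C /\ e \in C.

Definition oriented_cactus : Prop :=
  cactus /\ forall C, simple_cycle C -> directed_cycle C.

End Subgraphs.

(** * Graph monomials *)

Record graph_monomial (L : nat) (K : Type) := GraphMonomial {
  gm_graph :> digraph;
  gm_in : vertex gm_graph;
  gm_out : vertex gm_graph;
  gm_ell : edge gm_graph -> 'I_L;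
  gm_k : edge gm_graph -> K;
  gm_connected : connected_graph (whole_graph gm_graph) }.

Arguments gm_ell {L K} _ _.
Arguments gm_k {L K} _ _.

Definition cactus_type (L : nat) (K : Type) (g : graph_monomial L K) : Prop :=
  oriented_cactus g /\ gm_in g = gm_out g.

Definition gm_eval (C : comNzRingType) (L : nat) (K : Type) (N : nat)
    (A : 'I_L -> K -> 'M[C]_N) (g : graph_monomial L K) : 'M[C]_N :=
  \matrix_(i, j)
    \sum_(phi : {ffun vertex g -> 'I_N} |
            (phi (gm_in g) == j) && (phi (gm_out g) == i))
      \prod_(e : edge g)
        A (gm_ell g e) (gm_k g e) (phi (tgt e)) (phi (src e)).

(** * Matrices *)

Definition mxdelta (C : comNzRingType) (N : nat) (A : 'M[C]_N) : 'M[C]_N :=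
  \matrix_(i, j) (A i j *+ (i == j)).

(* Substitution of [X] for the indeterminates of the noncommutative monomial
   b_0 X_{k(0)} b_1 X_{k(1)} ... X_{k(d-1)} b_d. *)
Definition nc_monomial_eval (C : comNzRingType) (K : Type) (N d : nat)
    (b : 'I_d.+1 -> 'M[C]_N) (k : 'I_d -> K) (X : K -> 'M[C]_N) : 'M[C]_N :=
  b ord0 *m \big[mulmx/1%:M]_(j < d) (X (k j) *m b (lift ord0 j)).

(* The p-th power of a positive semidefinite matrix for a real exponent p, by
   functional calculus on the library's spectral decomposition. *)
Definition psd_powR (R : realType) (N : nat) (M : 'M[R[i]]_N) (p : R) :
    'M[R[i]]_N :=
  invmx (spectralmx M) *m
    diag_mx (map_mx (fun z : R[i] => (complex.Re z `^ p)%:C)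
                    (spectral_diag M)) *m
    spectralmx M.

(** * Bounded complex random variables and random matrices *)

Section Probability.
Context (R : realType) (d : measure_display) (T : measurableType d).
Variable P : probability T R.

(* Elements of L^oo are given by representatives, i.e. measurable essentially
   bounded functions. *)
Definition Linfty_rv (X : T -> R[i]) : Prop :=
  (fun w => complex.Re (X w)) \in Lfun P +oo%E /\
  (fun w => complex.Im (X w)) \in Lfun P +oo%E.

Definition Linfty_mx (N : nat) (A : T -> 'M[R[i]]_N) : Prop :=
  forall i j, Linfty_rv (fun w => A w i j).

Definition expectc (X : T -> R[i]) : R[i] :=
  Rintegral P setT (fun w => complex.Re (X w)) +i*
  Rintegral P setT (fun w => complex.Im (X w)).

End Probability.

Section FamilyLaws.
Context (R : realType) (N : nat).

(* The product sigma-algebra on families of N x N complex matrices, the one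
   generated by the real and imaginary parts of all entries. *)
Definition coordinate_sets (K : Type) : set (set (K -> 'M[R[i]]_N)) :=
  [set B | exists (k : K) (i j : 'I_N) (U : set R), measurable U /\
     (B = [set X : K -> 'M[R[i]]_N | U (complex.Re (X k i j))] \/
      B = [set X : K -> 'M[R[i]]_N | U (complex.Im (X k i j))])].

Definition family_measurable (K : Type) : set (set (K -> 'M[R[i]]_N)) :=
  <<s @coordinate_sets K >>.

Context (d : measure_display) (T : measurableType d).
Variables (P : probability T R) (K : Type).
Implicit Types A : K -> T -> 'M[R[i]]_N.

Definition family_event A (B : set (K -> 'M[R[i]]_N)) : set T :=
  [set w | B (fun k => A k w)].

Definition same_joint_law A A' : Prop :=
  forall B, family_measurable B -> P (family_event A B) = P (family_event A' B).

Definition permutation_invariant A : Prop :=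
  forall s : 'S_N,
    same_joint_law A (fun k w => perm_mx s *m A k w *m invmx (perm_mx s)).

Definition independent_families (L : nat) (A : 'I_L -> K -> T -> 'M[R[i]]_N) :
    Prop :=
  forall (J : {set 'I_L}) (B : 'I_L -> set (K -> 'M[R[i]]_N)),
    (forall l, family_measurable (B l)) ->
    P (\bigcap_(l in [set` J]) family_event (A l) (B l)) =
    (\prod_(l in J) P (family_event (A l) (B l)))%E.

End FamilyLaws.

(* In the graph monomials of a family, transposing a matrix amounts to reversing
   an edge, so that the complex conjugate and the adjoint of a matrix play the
   same role here.  The condition below holds for every family of real matrices,
   every family of Hermitian matrices, and every family closed under adjoint.
   Without it, hypotheses on the numbers E[prod_i Tr g_i(A)] give no control of
   A: they all vanish, trivial graphs excepted, when A is multiplied by an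
   independent uniform random phase, whatever the size of A. *)
Definition conj_stable (R : realType) (K : Type) (d : nat -> measure_display)
    (T : forall N, measurableType (d N)) (P : forall N, probability (T N) R)
    (A : forall N, K -> T N -> 'M[R[i]]_N) : Prop :=
  forall k : K, exists k' : K,
    (forall N, {ae P N, forall w, A N k' w = map_mx conjc (A N k w)}) \/
    (forall N, {ae P N, forall w, A N k' w = (A N k w)^t*}).

(* Main.v *)
Require Import Defs.
From HB Require Import structures.
From mathcomp Require Import all_boot all_order all_algebra.
From mathcomp Require Import perm complex.
From mathcomp Require Import all_classical all_reals all_analysis.
From mathcomp Require Import measurable_realfun ess_sup_inf.
From mathcomp Require Import zify ring lra.

Set Implicit Arguments.
Unset Strict Implicit.
Unset Printing Implicit Defensive.

Import Order.TTheory GRing.Theory Num.Theory.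
Import numFieldNormedType.Exports.

(** The matrix eps_N is diagonal, so the trace of (eps_N eps_N^* )^p is the sum over i of
    |eps_N(i,i)|^(2p), and the inequality x^p <= x^m + x^(m+1), with m the integer
    part of p, leaves only integer powers.  By the assumption on conjugates such a
    sum is, almost surely, a sum over maps phi from the vertices of one fixed graph
    to [N] of products of entries of the matrices: the graph is a bouquet of closed
    paths, one for each factor eps_N(i,i) or its conjugate, with cacti attached.  The
    i-th segment of a path carries the colour l_i, and subtracting the diagonal
    forces phi to take distinct values at the two ends of a segment.

    Grouping the maps phi by their kernel gives finitely many sums over injective
    maps on quotient graphs.  Independence and permutation invariance make the
    expectation of an injective sum equal to the product over the colours of the
    injective sums of the monochromatic subgraphs, divided by the (L-1)-st power of
    the number of injections (injective_sum_factor).  The growth hypothesis and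
    Moebius inversion bound each colour (injective_sum_order), so everything rests on
    the exponent of N.

    For the exponent, the leaf number f of a graph is rewritten as a weight: the two-edge
    connected components give disjoint vertex sets S with f = sum of 2 - |boundary of S|
    over those with at most one boundary edge (leaf_number_le).  Such weights are
    monotone under identification of vertices, which the inversion needs.
    Put the vertices and the sets S of all colours in one bipartite incidence graph.
    Its Euler characteristic is at most its number of components; the whole graph being
    two-edge connected, each of several components is paid for by two boundary edges
    or by uncovered vertices.  The exponent is therefore at most 1, and it equals 1 only
    if the incidence graph is a tree and no set S has a boundary (exponent_bound).
    In that case the path of eps_N would be a closed walk without backtracking in a
    tree, because consecutive colours differ and the ends of a segment are distinct:
    this is impossible.  The exponent being a multiple of 1/2, the expectation of the
    unnormalised trace is O(N^(1/2)), and the normalised one tends to zero. *)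

Local Notation adjacent := Defs.adjacent.

(** * Disjoint vertex sets and the exponent of N *)

(** Identifying the two ends of one pair costs at most one value of [kappa]; this is the
    inequality between the numbers of vertices, edges and components of a graph. *)
Lemma merge_labels (U : finType) (s : seq (U * U)) :
  exists kappa : U -> U,
    (forall p, p \in s -> kappa p.1 = kappa p.2) /\
    #|U| <= #|codom kappa| + size s.
Proof.
elim: s => [|[a b] s [kappa [ks kn]]].
  exists id; split => //; rewrite addn0.
  by apply/subset_leq_card/fintype.subsetP => x _; apply/codomP; exists x.
exists (fun x => if kappa x == kappa b then kappa a else kappa x); split.
  move=> p; rewrite inE => /orP[/eqP -> /=|/ks e].
    by rewrite eqxx; case: ifP.
  by rewrite e.
rewrite addnS -addSn; apply: leq_trans kn _; rewrite leq_add2r.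
set k' := fun x => _.
rewrite -[in X in _ <= X]add1n.
apply: leq_trans (_ : #|[predU1 kappa b & codom k']| <= _).
  apply/subset_leq_card/fintype.subsetP => y /codomP[x ->]; rewrite !inE.
  case: eqVneq => //= h; apply/codomP; exists x.
  by rewrite /k' (negbTE h).
by rewrite cardU1 leq_add2r; case: (_ \in _).
Qed.

Definition boundary (V E : finType) (src tgt : E -> V) (W : pred V) : nat :=
  #|[pred e | W (src e) != W (tgt e)]|.

(** The fibres of [lam] are disjoint vertex sets, and the weight is twice the power of N
    that they account for.  Each fibre counts 2, 1 or 0, as does a two-edge connected
    component in the leaf number. *)
Definition weight (V E : finType) (src tgt : E -> V) (I : finType)
    (lam : V -> option I) : nat :=
  \sum_(x : I) (2 - boundary src tgt (fun v => lam v == Some x)).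

Definition onto_labels (V I : finType) (lam : V -> option I) :=
  forall x, exists v, lam v = Some x.

(** A bound for all families at once: unlike the leaf number, it is obviously inherited
    by the graphs obtained by identifying vertices. *)
Definition weight_le (V E : finType) (src tgt : E -> V) (w : nat) :=
  forall (I : finType) (lam : V -> option I), onto_labels lam ->
    weight src tgt lam <= w.

Definition colour_class (E : finType) (L : nat) (c : E -> 'I_L) (l : 'I_L) :=
  [pred e | c e == l].

Section Exponent.
Variables (V E : finType) (src tgt : E -> V) (L : nat) (c : E -> 'I_L).
Variables (I : 'I_L -> finType) (lam : forall l, V -> option (I l)).
Hypothesis lam_onto : forall l, onto_labels (lam l).
Hypothesis two_cut : forall W : pred V, (exists v, W v) -> (exists v, ~~ W v) ->
  2 <= boundary src tgt W.

Definition colour_boundary (x : {l : 'I_L & I l}) : nat :=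
  #|[pred e | (c e == tag x) &&
      ((lam (tag x) (src e) == Some (tagged x)) !=
       (lam (tag x) (tgt e) == Some (tagged x)))]|.

(* U carries the bipartite graph of the incidences between vertices and label classes. *)
Let U : finType := (V + {l : 'I_L & I l})%type.

Definition incidence (p : V * 'I_L) : option (U * U) :=
  omap (fun x => (inl p.1 : U, inr (Tagged I x) : U)) (lam p.2 p.1).

(* What the weights lose against 2 for each label class and each covered vertex. *)
Let nones := #|[pred p : V * 'I_L | lam p.2 p.1 == None]|.
Let defect := 2 * nones + \sum_x minn 2 (colour_boundary x).

Lemma size_incidence : size (pmap incidence (enum {: V * 'I_L})) + nones
  = #|V| * L.
Proof.
rewrite size_pmap -[L in RHS]card_ord -card_prod cardE -(count_predC incidence).
congr addn; rewrite /nones -sum1_card -sum1_count big_enum_cond /=.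
by apply: eq_bigl => p; rewrite inE /incidence; case: (lam _ _).
Qed.

(** Let W be the set of vertices in one class of [kappa].  At least two edges cross W, and
    at its end in W each is either uncovered in its colour, or in the boundary of a
    label class contained in W.  So every class contributes two to the defect. *)
Lemma class_defect (kappa : U -> U) :
  (forall p q, incidence p = Some q -> kappa q.1 = kappa q.2) ->
  2 <= #|codom kappa| -> 2 * #|codom kappa| <= defect.
Proof.
move=> kc k2.
have kl l v x : lam l v = Some x -> kappa (inl v) = kappa (inr (Tagged I x)).
  by move=> e; have := kc (v, l) _; rewrite /incidence /= e => /(_ _ erefl).
pose Dy y := 2 * #|[pred p : V * 'I_L | (lam p.2 p.1 == None) && (kappa (inl p.1) == y)]|
  + \sum_(x | kappa (inr x) == y) minn 2 (colour_boundary x).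
have -> : defect = \sum_(y : U) Dy y.
  rewrite big_split /= -big_distrr /=; congr (_ * _ + _).
    rewrite /nones -sum1_card (partition_big (fun p => kappa (inl p.1)) xpredT) //=.
    by apply: eq_bigr => y _; rewrite -sum1_card; apply: eq_bigl => p; rewrite !inE.
  by rewrite (partition_big (fun x => kappa (inr x)) xpredT).
rewrite mulnC -sum_nat_const [X in _ <= X](bigID (mem (codom kappa))) /=.
apply: leq_trans (leq_addr _ _); apply: leq_sum => y yk.
pose W : pred V := fun v => kappa (inl v) == y.
have repr z : z \in codom kappa -> exists v, kappa (inl v) = z.
  move=> /codomP[[v ->|[l x] ->]]; first by exists v.
  by have [v e] := lam_onto x; exists v; rewrite (kl _ _ _ e).
have W1 : exists v, W v by have [v vy] := repr _ yk; exists v; rewrite /W vy.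
have W2 : exists v, ~~ W v.
  have /existsP[z /andP[zk zy]] : [exists z, (z \in codom kappa) && (z != y)].
    apply/contraT; rewrite negb_exists => /forallP h.
    suff : #|codom kappa| <= 1 by rewrite leqNgt k2.
    rewrite -(card1 y); apply/subset_leq_card/fintype.subsetP => z zk.
    by have := h z; rewrite zk /= negbK inE.
  by have [v vz] := repr _ zk; exists v; rewrite /W vz.
have := two_cut W1 W2; rewrite /boundary.
case/card_gt1P => e1 [e2 []]; rewrite !inE => h1 h2 e12.
case: (posnP #|[pred p : V * 'I_L | (lam p.2 p.1 == None) && (kappa (inl p.1) == y)]|); last first.
  by rewrite /Dy; lia.
move=> N0.
have nN l v : W v -> exists x, lam l v = Some x.
  move=> Wv; case e: (lam l v) => [x|]; first by exists x.
  by have := card0_eq N0 (v, l); rewrite !inE /= e eqxx; rewrite /W in Wv; rewrite Wv.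
have hx e : W (src e) != W (tgt e) -> exists x, [/\ kappa (inr x) = y, tag x = c e &
   (lam (tag x) (src e) == Some (tagged x)) != (lam (tag x) (tgt e) == Some (tagged x))].
  have out l (x : I l) v : kappa (inr (Tagged I x)) = y -> ~~ W v -> lam l v != Some x.
    by move=> kx; apply: contra => /eqP /kl e'; rewrite /W e' kx.
  case Ws: (W (src e)); case Wt: (W (tgt e)) => // _.
    have [x ex] := nN (c e) _ Ws; exists (Tagged I x).
    have kx : kappa (inr (Tagged I x)) = y by rewrite -(kl _ _ _ ex) (eqP Ws).
    by split => //=; rewrite ex eqxx (negbTE (out _ _ _ kx _)) ?Wt.
  have [x ex] := nN (c e) _ Wt; exists (Tagged I x).
  have kx : kappa (inr (Tagged I x)) = y by rewrite -(kl _ _ _ ex) (eqP Wt).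
  by split => //=; rewrite ex eqxx (negbTE (out _ _ _ kx _)) ?Ws.
have [x1 [k1 t1 b1]] := hx _ h1; have [x2 [k2' t2 b2]] := hx _ h2.
apply: leq_trans (leq_addl _ _).
have pos x e : tag x = c e ->
   (lam (tag x) (src e) == Some (tagged x)) != (lam (tag x) (tgt e) == Some (tagged x)) ->
   0 < colour_boundary x.
  by move=> te be; apply/card_gt0P; exists e; rewrite inE -te eqxx.
have [x12|x12] := eqVneq x1 x2.
  rewrite (bigD1 x1) ?k1 ?eqxx //=; apply: leq_trans (leq_addr _ _).
  rewrite leq_min /=; apply/card_gt1P; exists e1, e2; split => //; rewrite inE.
    by rewrite -t1 eqxx.
  by rewrite x12 -t2 eqxx.
rewrite (bigD1 x1) ?k1 ?eqxx //= (bigD1 x2) /=; last first.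
  by rewrite k2' eqxx eq_sym x12.
have m z : 0 < colour_boundary z -> 0 < minn 2 (colour_boundary z) by rewrite leq_min.
have m1 := m _ (pos _ _ t1 b1); have m2 := m _ (pos _ _ t2 b2).
by apply: leq_add m1 (leq_trans m2 (leq_addr _ _)).
Qed.

Lemma sum_weight_defect :
  \sum_x (2 - colour_boundary x) + \sum_x minn 2 (colour_boundary x) = 2 * #|{: {l : 'I_L & I l}}|.
Proof.
rewrite -big_split /= mulnC -sum_nat_const; apply: eq_bigr => x _; lia.
Qed.

Section Walk.
Variables (n : nat) (x : nat -> V) (col : nat -> 'I_L).
Hypothesis n_gt0 : 0 < n.
Hypothesis x_closed : x 0 = x n.
Hypothesis x_step : forall s, s < n -> x s != x s.+1.
Hypothesis col_step : forall s, s.+1 < n -> col s != col s.+1.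
Hypothesis x_col : forall s, s < n -> forall W : pred V,
  (forall e, c e = col s -> W (src e) = W (tgt e)) -> W (x s) = W (x s.+1).

(** Without defect the colours of each step stay inside one label class, so that [x] and
    [col] trace a closed walk without backtracking in the incidence graph.  A shortest
    closed portion of it is a cycle, and one incidence of a cycle is redundant. *)
Lemma redundant_incidence : defect = 0 ->
  exists p0 : V * 'I_L, forall kappa : U -> U,
    (forall p q, p != p0 -> incidence p = Some q -> kappa q.1 = kappa q.2) ->
    (forall p q, incidence p = Some q -> kappa q.1 = kappa q.2).
Proof.
move=> D0.
have N0 : nones = 0 by rewrite /defect in D0; lia.
have B0 z : colour_boundary z = 0.
  have : \sum_x minn 2 (colour_boundary x) = 0 by rewrite /defect in D0; lia.
  by move/eqP; rewrite sum_nat_eq0 => /forallP/(_ z) /=; lia.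
have lamS l v : lam l v != None.
  have := card0_eq N0 (v, l); rewrite !inE /= => ->; exact: isT.
have lamK s : s < n -> lam (col s) (x s) = lam (col s) (x s.+1).
  move=> sn; case e: (lam (col s) (x s)) (lamS (col s) (x s)) => [a|//] _.
  have := x_col sn (W := fun v => lam (col s) v == Some a).
  rewrite e eqxx => h; apply/esym/eqP; rewrite -h // => e' ce'.
  have := card0_eq (B0 (Tagged I a)) e'; rewrite !inE /= ce' eqxx /=.
  by move/negbFE/eqP.
pose node v l : U := if lam l v is Some a then inr (Tagged I a) else inl v.
(* The walk visits x 0, the class of colour col 0, x 1, and so on: even times are
   vertices, odd times are classes, and p i is the incidence used at time i. *)
pose p i := (x (uphalf i), col i./2).
pose y i : U := if odd i then node (x i./2) (col i./2) else inl (x i./2).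
have nodeE v l : exists a : I l, lam l v = Some a /\ node v l = inr (Tagged I a).
  by rewrite /node; case: (lam l v) (lamS l v) => // a _; exists a.
have yp i : i < n.*2 -> exists q, incidence (p i) = Some q /\
    ((q.1 = y i /\ q.2 = y i.+1) \/ (q.1 = y i.+1 /\ q.2 = y i)).
  move=> i2n; rewrite /y /p /incidence /= uphalf_half.
  have in2 : i./2 < n by lia.
  case oi: (odd i) => /=.
    have [a [ea na]] := nodeE (x i./2) (col i./2).
    rewrite ?add1n -(lamK _ in2) // ea /=; eexists; split; first by [].
    by right; rewrite /= na ?add1n.
  have [a [ea na]] := nodeE (x i./2) (col i./2).
  rewrite ?add0n ea /=; eexists; split; first by [].
  by left; rewrite /= na.
have yE i j : i < n.*2 -> j < n.*2 -> p i = p j -> y i = y j \/ (y i = y j.+1 /\ y i.+1 = y j).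
  move=> ii jj pij; have [q [Eq hq]] := yp i ii; have [q' [Eq' hq']] := yp j jj.
  move: Eq'; rewrite -pij Eq => -[qq]; rewrite -qq in hq'.
  case: hq => -[<- <-]; case: hq' => -[<- <-]; by auto.
have gap1 i : y i <> y i.+1.
  rewrite /y /=; case: (odd i) => /=; rewrite /node.
    by case: (lam _ _) (lamS (col i./2) (x i./2)).
  by case: (lam _ _) (lamS (col (uphalf i)) (x (uphalf i))).
have gap2 i : i.+2 <= n.*2 -> y i <> y i.+2.
  move=> i2; rewrite /y /= negbK.
  case oi: (odd i) => /=; last first.
    by case=> xx; have := x_step (s := i./2); rewrite xx eqxx; lia.
  have [a [_ ->]] := nodeE (x i./2) (col i./2).
  have [b [_ ->]] := nodeE (x (i./2).+1) (col (i./2).+1).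
  move/(congr1 (fun u : U => if u is inr z then tag z else col i./2)) => /= cc.
  by have := col_step (s := i./2); rewrite -cc eqxx; lia.
(* d is the length of a shortest closed portion; it is at least 3. *)
pose rep d := (0 < d) && [exists a : 'I_(n.*2.+1), (a + d <= n.*2) && (y a == y (a + d))].
have exd : exists d, rep d.
  exists n.*2; rewrite /rep double_gt0 n_gt0; apply/existsP; exists ord0.
  by rewrite add0n leqnn /= /y /= odd_double doubleK x_closed.
case: (ex_minnP exd) => d /andP[d0 /existsP[a /andP[ad /eqP yad]]] dmin.
have distinct i j : i < j -> j - i < d -> j <= n.*2 -> y i <> y j.
  move=> ij jid jn yij.
  have : rep (j - i).
    rewrite /rep subn_gt0 ij; apply/existsP.
    have iin : i < n.*2.+1 by lia.
    by exists (Ordinal iin); rewrite /= subnKC ?(ltnW ij)// jn yij eqxx.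
  by move/dmin; lia.
have d3 : 3 <= d.
  case: d d0 ad yad {dmin distinct} => [|[|[|d]]] // _ ad.
    by rewrite addn1 => /gap1.
  by rewrite addn2 in ad *; move/gap2 => /(_ ad).
exists (p a) => kappa kk.
have an : a < n.*2 by lia.
have step j : a < j -> j < a + d -> kappa (y j) = kappa (y j.+1).
  move=> aj jd.
  have jn : j < n.*2 by lia.
  have [q [Eq hq]] := yp j jn.
  have pj : p j != p a.
    apply/eqP => pja; have [e|[e1 e2]] := yE _ _ jn an pja.
      by apply: (distinct a j) => //; lia.
    have [ja|ja] := eqVneq j a.+1.
      by move: e2; rewrite ja => /esym; apply: distinct; lia.
    by move: e1 => /esym; apply: distinct; lia.
  by have := kk _ _ pj Eq; case: hq => -[-> ->].
have steps j : j < d -> kappa (y a.+1) = kappa (y (a + j.+1)).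
  elim: j => [|j IH] jd; first by rewrite addn1.
  by rewrite IH ?(ltnW jd)// step -?addnS //; lia.
have kya : kappa (y a) = kappa (y a.+1).
  by rewrite (steps d.-1) ?prednK // ?yad //; lia.
move=> q r; have [-> Er|/kk] := eqVneq q (p a); last exact.
have [q' [Eq hq]] := yp a an; move: Er; rewrite Eq => -[<-].
by case: hq => -[-> ->].
Qed.

(** With at least two classes the defect pays for all of them.  A single class leaves
    a surplus of 2, of which at least one unit is recovered, from a positive defect or
    from the cycle in the incidence graph. *)
Lemma exponent_bound :
  \sum_l weight (fun e : {e | e \in colour_class c l} => src (val e))
                (fun e : {e | e \in colour_class c l} => tgt (val e)) (lam l)
   <= 2 * (L.-1 * #|V|) + 1.
Proof.
have -> : \sum_l weight (fun e : {e | e \in colour_class c l} => src (val e))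
                (fun e : {e | e \in colour_class c l} => tgt (val e)) (lam l)
   = \sum_x (2 - colour_boundary x).
  rewrite (eq_bigr (fun l => \sum_(a : I l) (2 - colour_boundary (Tagged I a)))) => [|l _].
    rewrite (@sig_big_dep _ _ _ _ I xpredT (fun _ => xpredT) (fun l a => 2 - colour_boundary (Tagged I a))) /=.
    by apply: eq_bigr; case.
  apply: eq_bigr => a _; congr (2 - _).
  rewrite /boundary /colour_boundary /= -!sum1_card.
  rewrite [LHS](eq_bigl (fun e : {e | e \in colour_class c l} =>
     (lam l (src (val e)) == Some a) != (lam l (tgt (val e)) == Some a))) //.
  rewrite -(big_sub_cond (colour_class c l)
     (fun e => (lam l (src e) == Some a) != (lam l (tgt e) == Some a)) (fun _ => 1)).
  by apply: eq_bigl => e; rewrite !inE.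
have L0 : 0 < L by case: (L) (col 0) => // -[].
have SW := sum_weight_defect.
have SI := size_incidence.
have LV : #|V| * L = L.-1 * #|V| + #|V| by rewrite -{1}(prednK L0) mulnS mulnC addnC.
have CU : #|{: U}| = #|V| + #|{: {l : 'I_L & I l}}| by rewrite card_sum.
have bound (kappa : U -> U) f : (forall p q, incidence p = Some q -> kappa q.1 = kappa q.2) ->
   #|U| + f <= #|codom kappa| + size (pmap incidence (enum {: V * 'I_L})) ->
   (defect = 0 -> 0 < f) ->
    \sum_x (2 - colour_boundary x) <= 2 * (L.-1 * #|V|) + 1.
  move=> kc kn kf.
  have := class_defect kc.
  case: (leqP 2 #|codom kappa|) => [_ /(_ isT) |k2 _].
    rewrite /defect; lia.
  have [D0|D0] := posnP defect; last by move: D0; rewrite /defect; lia.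
  by have := kf D0; move: D0; rewrite /defect; lia.
have [D0|D0] := posnP defect; last first.
  have [kappa [kc kn]] := merge_labels (pmap incidence (enum {: V * 'I_L})).
  apply: (bound kappa 0); last by move=> D0'; move: D0; rewrite D0'.
    move=> p q pq; apply: kc; rewrite mem_pmap -pq; apply/map_f; exact: mem_enum.
  by rewrite addn0.
have [p0 hp0] := redundant_incidence D0.
have N0 : nones = 0 by rewrite /defect in D0; lia.
have S0 q : size (pmap incidence (q :: rem p0 (enum {: V * 'I_L}))) = (size (pmap incidence (rem p0 (enum {: V * 'I_L})))).+1.
  have := card0_eq N0 q; rewrite /= inE /incidence.
  by case: (lam q.2 q.1).
have SP : size (pmap incidence (enum {: V * 'I_L})) = (size (pmap incidence (rem p0 (enum {: V * 'I_L})))).+1.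
  rewrite -(S0 p0) !size_pmap; apply: (seq.permP (perm_to_rem _)); exact: mem_enum.
have [kappa [kc kn]] := merge_labels (pmap incidence (rem p0 (enum {: V * 'I_L}))).
apply: (bound kappa 1) => //; last by rewrite SP; lia.
apply: hp0 => p q pp0 pq; apply: kc; rewrite mem_pmap -pq; apply/map_f.
by rewrite (rem_filter _ (enum_uniq _)) mem_filter /= pp0 mem_enum.
Qed.

End Walk.
End Exponent.

(** * Leaves of the forest of two-edge connected components *)

Section Leaves.
Variable G : digraph.
Implicit Types (W : pred (vertex G)) (H : subgraph G) (F : {set edge G}).

Definition crosses W (e : edge G) := W (src e) != W (tgt e).

Definition splits W H :=
  (exists2 x, x \in H.1 & W x) /\ (exists2 x, x \in H.1 & ~~ W x).

Lemma adjacent_sym F : connect_sym (adjacent F).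
Proof.
apply: sym_connect_sym => x y; apply: eq_existsb => e.
by rewrite orbC.
Qed.

Lemma adjacent_edge F e : e \in F -> adjacent F (src e) (tgt e).
Proof. by move=> eF; apply/existsP; exists e; rewrite eF !eqxx. Qed.

Lemma connect_uncrossed F W x y : (forall e, e \in F -> ~~ crosses W e) ->
  connect (adjacent F) x y -> W x = W y.
Proof.
move=> nc /connectP[p pth ->]; elim: p x pth => //= z p IH x /andP[xz pth].
rewrite -(IH _ pth); case/existsP: xz => e /andP[/nc]; rewrite negbK => /eqP h.
by case/orP => /andP[/eqP <- /eqP <-].
Qed.

Lemma subgraph_connect H x y : is_subgraph H -> x \in H.1 ->
  connect (adjacent H.2) x y -> y \in H.1.
Proof.
move=> /forallP sH xH cxy; have <- // : (x \in H.1) = (y \in H.1).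
apply: (connect_uncrossed (W := mem H.1) _ cxy) => e eH.
by have := sH e; rewrite eH negbK /= => /andP[-> ->].
Qed.

Lemma connected_crossed H W : connected_graph H -> splits W H ->
  exists2 e, e \in H.2 & crosses W e.
Proof.
move=> /andP[_ /forallP cH] [[x xH Wx] [y yH Wy]].
have /existsP[e /andP[]] : [exists e, (e \in H.2) && crosses W e]; last by exists e.
apply: contraT; rewrite negb_exists => /forallP nc.
have := cH x; rewrite xH => /forallP/(_ y); rewrite yH /=.
move/(connect_uncrossed (W := W)) => h; move: Wy; rewrite -h ?Wx // => e eH.
by have := nc e; rewrite eH.
Qed.

Lemma crossed_connected H : H.1 != finset.set0 ->
  (forall W, splits W H -> exists2 e, e \in H.2 & crosses W e) -> connected_graph H.
Proof.
move=> H0 hW; rewrite /connected_graph H0; apply/forallP => x; apply/implyP => xH.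
apply/forallP => y; apply/implyP => yH; apply/contraT => nxy.
have [|e eH] := hW (connect (adjacent H.2) x).
  by split; [exists x | exists y].
rewrite /crosses; have := connect1 (adjacent_edge eH) => ce.
case: (boolP (connect _ x (src e))) => [cs|cs].
  by rewrite (connect_trans cs ce).
case: (boolP (connect _ x (tgt e))) => [ct|//].
by rewrite adjacent_sym in ce; rewrite (connect_trans ct ce) in cs.
Qed.

Lemma nb_components_le1 H : connected_graph H -> nb_components H <= 1.
Proof.
move=> /andP[_ /forallP cH]; apply/card_le1_eqP => x y.
rewrite !inE => /andP[/eqP rx xH] /andP[/eqP ry yH].
have := cH x; rewrite xH => /forallP/(_ y); rewrite yH /= => /(fingraph.rootP (adjacent_sym _)).
by rewrite rx ry.
Qed.

Lemma root_subgraph H x : is_subgraph H -> x \in H.1 ->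
  fingraph.root (adjacent H.2) x \in [predI roots (adjacent H.2) & mem H.1].
Proof.
move=> sH xH; rewrite !inE roots_root ?(subgraph_connect sH xH) ?connect_root //.
exact: adjacent_sym.
Qed.

Lemma single_crossing_cut_edge H W e : is_subgraph H -> connected_graph H ->
  e \in H.2 -> (forall e', e' \in H.2 -> crosses W e' = (e' == e)) -> cut_edge H e.
Proof.
move=> sH cH eH hW; rewrite /cut_edge eH /=.
apply: leq_ltn_trans (nb_components_le1 cH) _.
have /andP[sH1 sH2] : (src e \in H.1) && (tgt e \in H.1).
  by have /forallP/(_ e) := sH; rewrite eH.
pose H' : subgraph G := (H.1, H.2 :\ e)%SET.
have sH' : is_subgraph H'.
  apply/forallP => e'; apply/implyP; rewrite /= !inE => /andP[_ e'H].
  by have /forallP/(_ e') := sH; rewrite e'H.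
apply/card_gt1P; exists (fingraph.root (adjacent H'.2) (src e)), (fingraph.root (adjacent H'.2) (tgt e)).
split; [exact: (root_subgraph (H := H')) | exact: (root_subgraph (H := H')) |].
apply/eqP => /(fingraph.rootP (adjacent_sym _))/(connect_uncrossed (W := W)) h.
have := hW e eH; rewrite eqxx /crosses h ?eqxx // => e'.
by rewrite /= !inE => /andP[ne e'H]; rewrite hW.
Qed.

(** Two-edge connectivity in terms of cuts, a form in which unions are easy. *)
Definition two_crossings H := forall W, splits W H ->
  2 <= #|[pred e | (e \in H.2) && crosses W e]|.

Lemma tec_two_crossings H : two_edge_connected H -> two_crossings H.
Proof.
case/and3P => sH cH /forallP nc W /(connected_crossed cH)[e eH We].
rewrite ltnNge; apply/negP => /card_le1_eqP h.
have /negP := nc e; apply; apply: (single_crossing_cut_edge (W := W)) => // e' e'H.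
have [->//|ne] := eqVneq e' e; apply/negbTE/negP => We'.
by move/eqP: ne; apply; apply: h; rewrite inE ?eH ?e'H.
Qed.

Lemma two_crossings_tec H : is_subgraph H -> H.1 != finset.set0 ->
  two_crossings H -> two_edge_connected H.
Proof.
move=> sH H0 hW; apply/and3P; split => //.
  apply: crossed_connected => // W /hW; rewrite ltnNge => h.
  have /card_gt0P[e] : 0 < #|[pred e | (e \in H.2) && crosses W e]| by lia.
  by rewrite inE => /andP[]; exists e.
apply/forallP => e; apply/negP => /andP[eH]; apply/negP; rewrite -leqNgt.
apply: (@leq_trans 1).
  apply: nb_components_le1; apply: crossed_connected => // W sW.
  have [e1 [e2 []]] := card_gt1P (hW W sW); rewrite !inE => /andP[h1 c1] /andP[h2 c2] e12.
  have [ee|ne] := eqVneq e1 e; last by exists e1; rewrite //= !inE ne.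
  by exists e2; rewrite //= !inE h2 -ee eq_sym e12.
have /set0Pn[x xH] := H0.
by apply/card_gt0P; exists (fingraph.root (adjacent H.2) x); apply: root_subgraph.
Qed.

(** A cut that splits neither part would separate them, but both contain [x]. *)
Lemma tec_union H H' x : two_edge_connected H -> two_edge_connected H' ->
  x \in H.1 -> x \in H'.1 -> two_edge_connected (H.1 :|: H'.1, H.2 :|: H'.2)%SET.
Proof.
move=> tH tH' xH xH'; have cH := tec_two_crossings tH; have cH' := tec_two_crossings tH'.
case/and3P: tH => /forallP sH _ _; case/and3P: tH' => /forallP sH' _ _.
apply: two_crossings_tec.
- apply/forallP => e; apply/implyP; rewrite /= !inE.
  by case/orP => h; [have := sH e | have := sH' e]; rewrite h /= => /andP[-> ->]; rewrite ?orbT.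
- by apply/set0Pn; exists x; rewrite inE xH.
move=> W [[y yU Wy] [z zU Wz]]; rewrite /= in yU zU.
have sub (H1 : subgraph G) : H1.2 \subset (H.2 :|: H'.2)%SET -> two_crossings H1 ->
    splits W H1 -> 2 <= #|[pred e | (e \in (H.2 :|: H'.2)%SET) && crosses W e]|.
  move=> /fintype.subsetP s12 c1 s1; apply: leq_trans (c1 W s1) _.
  apply/subset_leq_card/fintype.subsetP => e; rewrite !inE => /andP[h ->].
  by have := s12 _ h; rewrite inE => ->.
have subl := sub H (finset.subsetUl _ _) cH.
have subr := sub H' (finset.subsetUr _ _) cH'.
move: yU zU; rewrite !inE => /orP[yU|yU] /orP[zU|zU].
- by apply: subl; split; [exists y | exists z].
- case Wx: (W x).
    by apply: subr; split; [exists x | exists z].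
  by apply: subl; split; [exists y | exists x => //; rewrite Wx].
- case Wx: (W x).
    by apply: subl; split; [exists x | exists z].
  by apply: subr; split; [exists y | exists x => //; rewrite Wx].
- by apply: subr; split; [exists y | exists z].
Qed.

Definition bridge (e : edge G) :=
  [exists W : {ffun vertex G -> bool}, [forall e', crosses W e' == (e' == e)]].

Definition nonbridges : {set edge G} := [set e | ~~ bridge e]%SET.

(** Cuts are closed under symmetric difference: adding to [W] the cut of a bridge removes
    that bridge from the edges crossing [W], until [e] alone is left. *)
Lemma nonbridge_crossing W e : e \in nonbridges ->
  ~ (forall e', e' \in nonbridges -> crosses W e' = (e' == e)).
Proof.
move=> eN; have [n] := ubnP #|[pred e' | bridge e' && crosses W e']|.
elim: n W => // n IH W; rewrite ltnS => Wn hW.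
have [b0|/card_gt0P[f]] := posnP #|[pred e' | bridge e' && crosses W e']|.
  have := eN; rewrite inE => /existsP; apply; exists (finfun W); apply/forallP => e'.
  rewrite /crosses !ffunE; apply/eqP.
  have [be'|nbe'] := boolP (bridge e'); last by apply: hW; rewrite inE.
  have := card0_eq b0 e'; rewrite !inE be' /= /crosses => ->.
  by apply/esym/negbTE/eqP => ee; move: eN; rewrite inE -ee be'.
rewrite inE => /andP[bf Wf]; have /existsP[Wb /forallP hWb] := bf.
have cW' e' : crosses (fun x => W x (+) Wb x) e' = crosses W e' (+) (e' == f).
  by rewrite -(eqP (hWb e')) /crosses; case: (W (src _)); case: (W (tgt _)); case: (Wb (src _)); case: (Wb (tgt _)).
apply: (IH (fun x => W x (+) Wb x)).
  apply: leq_trans Wn; apply: proper_card; apply/properP; split.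
    apply/fintype.subsetP => e'; rewrite !inE cW' => /andP[->].
    by case: eqVneq => [->|_] /=; rewrite ?Wf // addbF.
  by exists f; rewrite !inE bf ?Wf // cW' eqxx Wf.
move=> e' e'N; rewrite cW' hW //; case: (eqVneq e' f) => [ef|_]; last by rewrite addbF.
by move: e'N; rewrite inE ef bf.
Qed.

Definition nonbridge_component (a : vertex G) : subgraph G :=
  ([set x | connect (adjacent nonbridges) a x],
   [set e in nonbridges | connect (adjacent nonbridges) a (src e)])%SET.

Lemma nonbridge_connect a e : e \in nonbridges ->
  connect (adjacent nonbridges) a (src e) = connect (adjacent nonbridges) a (tgt e).
Proof.
move=> eN; have ce := connect1 (adjacent_edge eN).
by rewrite (same_connect_r (adjacent_sym _) ce).
Qed.

(** Deleting all bridges at once creates no new bridge. *)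
Lemma nonbridge_component_tec a : two_edge_connected (nonbridge_component a).
Proof.
apply: two_crossings_tec.
- apply/forallP => e; apply/implyP; rewrite /= !inE => /andP[eN cs].
  by rewrite cs -nonbridge_connect // inE.
- by apply/set0Pn; exists a; rewrite inE connect0.
move=> W [[x]]; rewrite /= inE => ax Wx [y]; rewrite /= inE => ay Wy.
pose Y : pred (vertex G) := fun x => connect (adjacent nonbridges) a x && W x.
have cY e : e \in nonbridges -> crosses Y e =
    (e \in (nonbridge_component a).2) && crosses W e.
  move=> eN; rewrite /crosses /Y -nonbridge_connect // /= [in RHS]finset.in_set eN /=.
  by case: (connect _ _ _).
rewrite ltnNge; apply/negP => /card_le1_eqP h.
have [/existsP[e /andP[eC We]]|] := boolP [exists e, (e \in (nonbridge_component a).2) && crosses W e].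
  have eN : e \in nonbridges by move: eC; rewrite !inE => /andP[].
  apply: (nonbridge_crossing (W := Y) eN) => e' e'N; rewrite cY //.
  apply/idP/eqP => [/andP[e'C We']|->]; last by rewrite eC.
  by apply: h; rewrite inE ?eC ?e'C.
rewrite negb_exists => /forallP nc.
have YY z : connect (adjacent nonbridges) a z -> Y a = Y z.
  by apply: connect_uncrossed => e eN; rewrite cY.
by move: Wy; have := YY _ ax; rewrite (YY _ ay) /Y ax ay Wx /= => ->.
Qed.

Lemma tec_component_max H H' x : H \in tec_components G -> two_edge_connected H' ->
  x \in H.1 -> x \in H'.1 -> sub_subgraph H' H.
Proof.
rewrite inE => /andP[tH /forallP mH] tH' xH xH'.
have := mH (H.1 :|: H'.1, H.2 :|: H'.2)%SET.
rewrite (tec_union tH tH' xH xH') /sub_subgraph /= !finset.subsetUl /= => /eqP eH.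
by rewrite -eH /= !finset.subsetUr.
Qed.

Lemma tec_component_eq H H' x : H \in tec_components G -> H' \in tec_components G ->
  x \in H.1 -> x \in H'.1 -> H = H'.
Proof.
move=> hH hH' xH xH'.
have tH : two_edge_connected H by move: hH; rewrite inE => /andP[].
have tH' : two_edge_connected H' by move: hH'; rewrite inE => /andP[].
have /andP[s1 s2] := tec_component_max hH tH' xH xH'.
have /andP[s3 s4] := tec_component_max hH' tH xH' xH.
case: H H' {hH hH' xH xH' tH tH'} s1 s2 s3 s4 => [A B] [A' B'] /= s1 s2 s3 s4.
have -> : A = A' by apply/eqP; rewrite finset.eqEsubset s3 s1.
by have -> : B = B' by apply/eqP; rewrite finset.eqEsubset s4 s2.
Qed.

(** Otherwise [H] could be enlarged by the bridgeless component of the edge. *)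
Lemma tec_component_boundary H e : connected_graph (whole_graph G) ->
  H \in tec_components G -> crosses (mem H.1) e -> cut_edge (whole_graph G) e.
Proof.
move=> cG hH eH.
have [/existsP[W /forallP hW]|nb] := boolP (bridge e).
  apply: (single_crossing_cut_edge (W := W) _ cG).
  - by apply/forallP => e'; rewrite /= !inE.
  - by rewrite /= inE.
  - by move=> e' _; exact: (eqP (hW e')).
have eN : e \in nonbridges by rewrite inE.
have key a : a \in H.1 -> forall y, connect (adjacent nonbridges) a y -> y \in H.1.
  move=> aH y ay.
  have aC : a \in (nonbridge_component a).1 by rewrite inE connect0.
  have /andP[/fintype.subsetP h _] := tec_component_max hH (nonbridge_component_tec a) aH aC.
  by apply: h; rewrite inE.
have cst := connect1 (adjacent_edge eN); have cts := cst; rewrite adjacent_sym in cts.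
move: eH; rewrite /crosses /=; case sH: (src e \in H.1); case tH: (tgt e \in H.1) => // _.
  by rewrite (key _ sH _ cst) in tH.
by rewrite (key _ tH _ cts) in sH.
Qed.

(** The leaf number is at most the weight of the labelling by two-edge connected
    components: these are disjoint, and their boundary edges are among the cut edges
    counted by the degree in the forest. *)
Lemma leaf_number_le w : connected_graph (whole_graph G) ->
  weight_le (@src G) (@tgt G) w -> leaf_number G <= w.
Proof.
move=> cG hw.
pose I : finType := {H : subgraph G | H \in tec_components G}.
pose lam (v : vertex G) : option I := [pick x : I | v \in (val x).1].
have lamE v (x : I) : (lam v == Some x) = (v \in (val x).1).
  rewrite /lam; case: pickP => [y vy|h]; last by rewrite h.
  apply/eqP/idP => [[<-]//|vx]; congr Some; apply/val_inj.
  exact: (tec_component_eq (valP y) (valP x) vy vx).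
apply: leq_trans (hw I lam _) => [|x]; last first.
  have := valP x; rewrite inE => /andP[/and3P[_ /andP[/set0Pn[v vx] _] _] _].
  by exists v; apply/eqP; rewrite lamE.
rewrite /leaf_number /weight big_sub; apply: leq_sum => x _.
apply: (@leq_trans (2 - forest_degree (val x))); first by case: forest_degree => [|[|]].
apply: leq_sub2l; rewrite /forest_degree /boundary.
apply/subset_leq_card/fintype.subsetP => e; rewrite !inE !lamE => ex.
rewrite (tec_component_boundary cG (valP x)) //=.
by move: ex; case: (_ \in _) => //; case: (_ \in _).
Qed.

End Leaves.

(** * Patterns: graphs with identified or separated vertices *)

Section Cactus.
Variable G : digraph.

(** Membership in [W] changes exactly at the crossing darts. *)
Lemma dart_path_crossings (W : pred (vertex G)) (d : dart G) s :
  path.path (fun d d' : dart G => dart_to d == dart_from d') d s ->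
  odd (count (crosses W) [seq x.1 | x <- d :: s]) =
  W (dart_from d) (+) W (dart_to (last d s)).
Proof.
have one (x : dart G) : crosses W x.1 = W (dart_from x) (+) W (dart_to x).
  by case: x => e []; rewrite /crosses /dart_from /dart_to /=; case: (W _); case: (W _).
elim: s d => [|d' s IH] d /=; first by rewrite addn0 oddb one.
move=> /andP[/eqP dd' /IH /=]; rewrite !oddD !oddb => ->.
by rewrite one dd'; case: (W _); case: (W _); case: (W _).
Qed.

(** A simple cycle crosses every cut an even number of times. *)
Lemma cactus_two_cut : cactus G -> forall W : pred (vertex G),
  (exists v, W v) -> (exists v, ~~ W v) -> 2 <= boundary (@src G) (@tgt G) W.
Proof.
move=> [cG cyc] W [x Wx] [y Wy].
have [|e _ We] := connected_crossed (W := W) cG.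
  by split; [exists x | exists y]; rewrite //= inE.
have [C [[[s /and4P[s0 cs _ us] ->] eC] _]] := cyc e.
have ev : ~~ odd (count (crosses W) [seq d.1 | d <- s]).
  case: s s0 cs {us eC} => // d s _ /=; rewrite rcons_path => /andP[ps /eqP ds].
  by have := dart_path_crossings W ps; rewrite ds addbb /= => ->.
have : 0 < count (crosses W) [seq d.1 | d <- s].
  by rewrite -has_count; apply/hasP; exists e => //; move: eC; rewrite inE.
have : count (crosses W) [seq d.1 | d <- s] <= boundary (@src G) (@tgt G) W.
  rewrite -size_filter -(card_uniqP (filter_uniq _ us)).
  by apply/subset_leq_card/fintype.subsetP => e'; rewrite mem_filter inE => /andP[].
case: (count _ _) ev => [|[|c]] // _ h _; exact: leq_trans h.
Qed.

End Cactus.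

(** A graph whose vertices are summed over subject to constraints.  An equality
    replaces the identification of two vertices, so that products of patterns need
    no quotient type; a disequality removes the diagonal of a matrix. *)
Record pattern (L : nat) (K : Type) := Pattern {
  pvertex : finType;
  pedge : finType;
  psrc : pedge -> pvertex;
  ptgt : pedge -> pvertex;
  pcol : pedge -> 'I_L;
  pkey : pedge -> K;
  peqs : seq (pvertex * pvertex);
  pneqs : seq (pvertex * pvertex);
  pin : pvertex;
  pout : pvertex }.

Section Patterns.
Variables (L : nat) (K : Type).
Implicit Types (G H : pattern L K).

Definition compatible G (T : eqType) (phi : pvertex G -> T) : bool :=
  all (fun p => phi p.1 == phi p.2) (peqs G) &&
  all (fun p => phi p.1 != phi p.2) (pneqs G).

Definition pweight (C : comNzRingType) N (A : 'I_L -> K -> 'M[C]_N) G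
    (phi : pvertex G -> 'I_N) : C :=
  (\prod_(e : pedge G) A (pcol e) (pkey e) (phi (ptgt e)) (phi (psrc e)))%R.

Definition peval (C : comNzRingType) N (A : 'I_L -> K -> 'M[C]_N) G : 'M[C]_N :=
  (\matrix_(i, j) \sum_(phi : {ffun pvertex G -> 'I_N} |
     [&& compatible phi, phi (pout G) == i & phi (pin G) == j]) pweight A phi)%R.

Definition pone : pattern L K :=
  @Pattern L K unit void (fun e => match e with end) (fun e => match e with end)
    (fun e => match e with end) (fun e => match e with end) [::] [::] tt tt.

Definition pletter (l : 'I_L) (k : K) : pattern L K :=
  @Pattern L K bool unit (fun _ => false) (fun _ => true) (fun _ => l) (fun _ => k)
    [::] [::] false true.

Definition pmonomial (g : graph_monomial L K) : pattern L K :=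
  @Pattern L K (vertex g) (edge g) (@src g) (@tgt g) (gm_ell g) (gm_k g)
    [::] [::] (gm_in g) (gm_out g).

Definition sum_fun (A B C : Type) (f : A -> C) (g : B -> C) (x : A + B) : C :=
  match x with inl a => f a | inr b => g b end.

Definition map_both (A B : Type) (f : A -> B) (s : seq (A * A)) : seq (B * B) :=
  [seq (f p.1, f p.2) | p <- s].

Definition pmul G H : pattern L K :=
  @Pattern L K (pvertex G + pvertex H)%type (pedge G + pedge H)%type
    (sum_fun (fun e => inl (psrc e)) (fun e => inr (psrc e)))
    (sum_fun (fun e => inl (ptgt e)) (fun e => inr (ptgt e)))
    (sum_fun (@pcol _ _ G) (@pcol _ _ H)) (sum_fun (@pkey _ _ G) (@pkey _ _ H))
    ((inl (pin G), inr (pout H)) ::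
       map_both inl (peqs G) ++ map_both inr (peqs H))
    (map_both inl (pneqs G) ++ map_both inr (pneqs H))
    (inr (pin H)) (inl (pout G)).

Definition pdelta G : pattern L K :=
  @Pattern L K _ _ (@psrc _ _ G) (@ptgt _ _ G) (@pcol _ _ G) (@pkey _ _ G)
    ((pout G, pin G) :: peqs G) (pneqs G) (pin G) (pout G).

Definition poffdiag G : pattern L K :=
  @Pattern L K _ _ (@psrc _ _ G) (@ptgt _ _ G) (@pcol _ _ G) (@pkey _ _ G)
    (peqs G) ((pout G, pin G) :: pneqs G) (pin G) (pout G).

(** Entrywise conjugation: each matrix becomes a member of the family equal to its
    conjugate or, after reversing the edge, to its adjoint. *)
Definition prelabel G (key : pedge G -> K) (flip : pred (pedge G)) : pattern L K :=
  @Pattern L K (pvertex G) (pedge G)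
    (fun e => if flip e then ptgt e else psrc e)
    (fun e => if flip e then psrc e else ptgt e) (@pcol _ _ G) key
    (peqs G) (pneqs G) (pin G) (pout G).

Lemma compatible_mul G H (T : eqType) (phi : pvertex (pmul G H) -> T) :
  compatible phi = [&& phi (inl (pin G)) == phi (inr (pout H)),
    compatible (fun v => phi (inl v)) & compatible (fun v => phi (inr v))].
Proof.
rewrite /compatible /= !all_cat /map_both !all_map -!andbA /=; congr andb.
by do !bool_congr.
Qed.

Section Eval.
Variables (C : comNzRingType) (N : nat) (A : 'I_L -> K -> 'M[C]_N).
Local Open Scope ring_scope.

Lemma peval_one : peval A pone = 1%:M.
Proof.
apply/matrixP => i j; rewrite !mxE.
have [<-|nij] := eqVneq i j.
  rewrite (big_pred1 [ffun _ => i]) /=.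
    by rewrite /pweight big1 //; case.
  move=> phi; rewrite /compatible /= andbb; apply/eqP/eqP => [h|->]; last by rewrite ffunE.
  by apply/ffunP => -[]; rewrite ffunE.
rewrite big_pred0 // => phi; rewrite /compatible /=.
by apply/negbTE/negP => /andP[/eqP h1 /eqP h2]; case/eqP: nij; rewrite -h1 -h2.
Qed.

Lemma peval_letter l k : peval A (pletter l k) = A l k.
Proof.
apply/matrixP => i j; rewrite !mxE.
rewrite (big_pred1 [ffun b : bool => if b then i else j]).
  by rewrite /pweight /= (big_pred1 tt) ?ffunE //; case.
move=> phi; rewrite /compatible /=; apply/andP/eqP => [[/eqP h1 /eqP h2]|->].
  by apply/ffunP => -[]; rewrite ffunE.
by rewrite !ffunE !eqxx.
Qed.

Lemma peval_monomial g : peval A (pmonomial g) = gm_eval A g.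
Proof.
by apply/matrixP => i j; rewrite !mxE; apply: eq_bigl => phi; rewrite /compatible /= andbC.
Qed.

Lemma peval_delta G : peval A (pdelta G) = mxdelta (peval A G).
Proof.
apply/matrixP => i j; rewrite !mxE; have [<-|nij] := eqVneq i j.
  rewrite mulr1n; apply: eq_bigl => phi; rewrite /compatible /=.
  case: (eqVneq (phi (pout G)) i) => [->|]; last by rewrite !andbF.
  by case: (eqVneq (phi (pin G)) i) => _; rewrite ?andbF ?andbT.
rewrite mulr0n big_pred0 // => phi; apply/negbTE/negP.
rewrite /compatible /= => /and3P[/andP[/andP[/eqP h _] _] /eqP h1 /eqP h2].
by case/eqP: nij; rewrite -h1 -h2.
Qed.

Lemma peval_offdiag G : peval A (poffdiag G) = peval A G - mxdelta (peval A G).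
Proof.
apply/matrixP => i j; rewrite !mxE; have [<-|nij] := eqVneq i j.
  rewrite mulr1n subrr big_pred0 // => phi; apply/negbTE/negP.
  rewrite /compatible /= => /and3P[/andP[_ /andP[/negP h _]] /eqP e1 /eqP e2].
  by apply: h; rewrite e1 e2.
rewrite mulr0n subr0; apply: eq_bigl => phi; rewrite /compatible /=.
case: (eqVneq (phi (pout G)) i) => [->|]; last by rewrite !andbF.
by case: (eqVneq (phi (pin G)) j) => [->|_]; rewrite ?nij ?andbF ?andbT.
Qed.

Definition ffun_join (V V' : finType) (T : Type) (f : {ffun V -> T}) (f' : {ffun V' -> T})
  : {ffun V + V' -> T} := [ffun x => sum_fun f f' x].

Lemma sum_ffun_join (V V' T : finType) (P : pred {ffun V + V' -> T})
    (F : {ffun V + V' -> T} -> C) :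
  \sum_(f | P f) F f =
  \sum_(f : {ffun V -> T}) \sum_(f' : {ffun V' -> T} | P (ffun_join f f')) F (ffun_join f f').
Proof.
rewrite pair_big_dep /=.
rewrite (reindex (fun p => ffun_join p.1 p.2)) //=.
exists (fun f => ([ffun x => f (inl x)], [ffun x => f (inr x)])) => [[f f']|f] _.
  by congr pair; apply/ffunP => x; rewrite !ffunE.
by apply/ffunP => -[x|x]; rewrite !ffunE /= ffunE.
Qed.

Lemma compatible_eq G (T : eqType) (phi psi : pvertex G -> T) :
  phi =1 psi -> compatible phi = compatible psi.
Proof.
by move=> h; congr andb; apply: eq_all => p; rewrite !h.
Qed.

(** The new equality makes the column index of one factor the row index of the other. *)
Lemma peval_mul G H : peval A (pmul G H) = peval A G *m peval A H.
Proof.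
apply/matrixP => i j; rewrite !mxE sum_ffun_join.
under [RHS]eq_bigr => m _ do rewrite !mxE big_distrl /=.
rewrite (eq_bigr (fun m => \sum_(f : {ffun pvertex G -> 'I_N} |
    (compatible f && (f (pout G) == i)) && (f (pin G) == m))
   (pweight A f * \sum_(f' : {ffun pvertex H -> 'I_N} |
    [&& compatible f', f' (pout H) == f (pin G) & f' (pin H) == j]) pweight A f'))); last first.
  move=> m _; rewrite [LHS](eq_bigl _ _ (fun f => andbA _ _ _)).
  by apply: eq_bigr => f /andP[_ /eqP ->].
rewrite -(partition_big (fun f : {ffun pvertex G -> 'I_N} => f (pin G)) xpredT) //=.
rewrite [RHS]big_mkcond /=; apply: eq_bigr => f _.
have cj f' : compatible (G := pmul G H) (ffun_join f f') =
    [&& f (pin G) == f' (pout H), compatible f & compatible f'].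
  rewrite compatible_mul !ffunE /=; congr [&& _, _ & _];
    by apply: compatible_eq => v; rewrite !ffunE.
case: ifP => [/andP[cf fi]|nf]; last first.
  rewrite big_pred0 // => f'; rewrite cj !ffunE /=.
  by move: nf; case: (compatible f) => /=; [move=> -> | ]; rewrite /= !andbF.
rewrite big_distrr /=; apply: eq_big => f'.
  by rewrite cj !ffunE /= cf fi [f (pin G) == _]eq_sym /= andbCA andbA.
move=> _; rewrite /pweight big_sumType /=; congr *%R.
  by apply: eq_bigr => e _; rewrite !ffunE.
by apply: eq_bigr => e _; rewrite !ffunE.
Qed.

Lemma peval_trace G : \tr (peval A G) =
  \sum_(phi : {ffun pvertex G -> 'I_N} | compatible (G := pdelta G) phi) pweight A phi.
Proof.
rewrite [RHS](partition_big (fun phi : {ffun pvertex G -> 'I_N} => phi (pout G)) xpredT) //=.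
apply: eq_bigr => i _; rewrite mxE; apply: eq_bigl => phi; rewrite /compatible /=.
case: (eqVneq (phi (pout G)) i) => [->|]; last by rewrite !andbF.
by rewrite [i == _]eq_sym; case: (phi (pin G) == i); rewrite /= ?andbT ?andbF.
Qed.

End Eval.

Definition saturated G (W : pred (pvertex G)) : bool :=
  all (fun p => W p.1 == W p.2) (peqs G).

(** The pattern becomes two-edge connected once an edge from input to output is added;
    this form is preserved by products. *)
Definition tec_pattern G := forall W : pred (pvertex G), saturated W ->
  (exists v, W v) -> (exists v, ~~ W v) ->
  2 <= boundary (@psrc _ _ G) (@ptgt _ _ G) W + (W (pin G) != W (pout G)).

(** Input and output are connected by edges of colour [l], in terms of cuts. *)
Definition coloured_link (l : 'I_L) G := forall W : pred (pvertex G), saturated W ->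
  (forall e, pcol e = l -> W (psrc e) = W (ptgt e)) -> W (pin G) = W (pout G).

Lemma saturated_mul G H (W : pred (pvertex (pmul G H))) :
  saturated W = [&& W (inl (pin G)) == W (inr (pout H)),
    saturated (fun v => W (inl v)) & saturated (fun v => W (inr v))].
Proof. by rewrite /saturated /= all_cat /map_both !all_map. Qed.

Lemma boundary_mul G H (W : pred (pvertex (pmul G H))) :
  boundary (@psrc _ _ (pmul G H)) (@ptgt _ _ (pmul G H)) W =
  boundary (@psrc _ _ G) (@ptgt _ _ G) (fun v => W (inl v)) +
  boundary (@psrc _ _ H) (@ptgt _ _ H) (fun v => W (inr v)).
Proof.
rewrite /boundary -!sum1_card big_mkcond big_sumType /=.
by congr (_ + _); rewrite -big_mkcond.
Qed.

Lemma tec_one : tec_pattern pone.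
Proof. by move=> W _ [[] w] [[]]; rewrite w. Qed.

Lemma tec_letter l k : tec_pattern (pletter l k).
Proof.
move=> W _ [x Wx] [y Wy].
have Wft : W false != W true.
  by case: x y Wx Wy => -[] /=; case: (W true); case: (W false).
rewrite /= Wft /boundary (eq_card (B := xpredT)) => [|e]; last by rewrite !inE.
by rewrite card_unit.
Qed.

Lemma tec_monomial g : cactus_type g -> tec_pattern (pmonomial g).
Proof. by move=> [[/cactus_two_cut cg _] _] W _ W1 W2; apply: leq_trans (cg W W1 W2) (leq_addr _ _). Qed.

(** A cut that separates the ends of a factor is crossed at least once there; the three
    memberships of input, middle and output decide how many crossings are left. *)
Lemma tec_mul G H : tec_pattern G -> tec_pattern H -> tec_pattern (pmul G H).
Proof.
move=> tG tH W; rewrite saturated_mul boundary_mul => /and3P[/eqP mid sG sH] W1 W2 /=.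
have {}tG := tG _ sG; have {}tH := tH _ sH.
have triv (T : finType) (X : pred T) : (exists v, X v) /\ (exists v, ~~ X v) \/ exists b, forall v, X v = b.
  have [/existsP e1|] := boolP [exists v, X v]; last first.
    by rewrite negb_exists => /forallP h; right; exists false => v; apply/negbTE.
  have [/existsP e2|] := boolP [exists v, ~~ X v]; first by left.
  by rewrite negb_exists => /forallP h; right; exists true => v; have := h v; rewrite negbK.
have [[g1 g2]|[b hb]] := triv _ (fun v => W (inl v)).
  have := tG g1 g2; have [[h1 h2]|[b' hb']] := triv _ (fun v => W (inr v)).
    by have := tH h1 h2; rewrite mid; case: (W _); case: (W _); case: (W _); lia.
  by rewrite mid !hb'; case: (W _); case: b' {hb'}; lia.
have [[h1 h2]|[b' hb']] := triv _ (fun v => W (inr v)).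
  by have := tH h1 h2; rewrite -mid !hb; case: (W _); case: b {hb}; lia.
have bb : b = b' by rewrite -(hb (pin G)) -(hb' (pout H)).
have all_b v : W v = b by case: v => v; rewrite ?hb ?hb' ?bb.
case: W1 => x Wx; case: W2 => y; rewrite all_b; by rewrite all_b in Wx; rewrite Wx.
Qed.

Lemma tec_delta G : tec_pattern G -> tec_pattern (pdelta G).
Proof. by move=> tG W /andP[_ sW]; apply: tG. Qed.

Lemma tec_offdiag G : tec_pattern G -> tec_pattern (poffdiag G).
Proof. by []. Qed.

Lemma tec_relabel G key flip : tec_pattern G -> tec_pattern (@prelabel G key flip).
Proof.
move=> tG W sW W1 W2; have := tG W sW W1 W2.
congr (_ <= _ + _); apply: eq_card => e; rewrite !inE /=.
by case: (flip e) => //; rewrite eq_sym.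
Qed.

Lemma link_letter l k : coloured_link l (pletter l k).
Proof. by move=> W _ h; apply: (h tt). Qed.

Lemma link_monomial l g : cactus_type g -> coloured_link l (pmonomial g).
Proof. by move=> [_ io] W _ _; rewrite /= io. Qed.

Lemma link_one l : coloured_link l pone.
Proof. by []. Qed.

Lemma link_mul l G H : coloured_link l G -> coloured_link l H -> coloured_link l (pmul G H).
Proof.
move=> lG lH W; rewrite saturated_mul => /and3P[/eqP mid sG sH] hW /=.
rewrite -(lG _ sG) ?mid; last by move=> e; apply: (hW (inl e)).
by rewrite (lH _ sH) // => e; apply: (hW (inr e)).
Qed.

(** [x] is a walk in the quotient by [r] that never stays in place and whose step [s]
    can be followed along edges of colour [col s]. *)
Definition coloured_chain G (V' : finType) (r : pvertex G -> V') n
    (col : nat -> 'I_L) (x : nat -> V') :=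
  forall s, s < n -> x s != x s.+1 /\
    forall W : pred V', (forall e, pcol e = col s -> W (r (psrc e)) = W (r (ptgt e))) ->
      W (x s) = W (x s.+1).

Definition has_chain G n (col : nat -> 'I_L) :=
  forall (V' : finType) (r : pvertex G -> V'), compatible r ->
    exists x, [/\ x 0 = r (pout G), x n = r (pin G) & coloured_chain r n col x].

Definition has_closed_chain G n (col : nat -> 'I_L) :=
  forall (V' : finType) (r : pvertex G -> V'), compatible r ->
    exists2 x, x 0 = x n & coloured_chain r n col x.

Lemma chain_one col : has_chain pone 0 col.
Proof. by move=> V' r _; exists (fun _ => r tt); split. Qed.

(** The disequality separates the ends that the link connects within one colour. *)
Lemma chain_offdiag l G : coloured_link l G -> has_chain (poffdiag G) 1 (fun _ => l).
Proof.
move=> lG V' r cr; exists (fun s => if s is 0 then r (pout G) else r (pin G)); split => //.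
move=> [|//] _; move: cr; rewrite /compatible /= => /and3P[sr nr _]; split => // W hW.
apply/esym; apply: (lG (fun v => W (r v))) => //.
by apply: sub_all sr => p /eqP ->.
Qed.

Lemma chain_mul l G H n col : has_chain G 1 (fun _ => l) -> has_chain H n col ->
  has_chain (pmul G H) n.+1 (fun s => if s is s'.+1 then col s' else l).
Proof.
move=> cG cH V' r; rewrite compatible_mul => /and3P[/eqP mid rG rH].
have [x [x0 x1 hx]] := cG _ _ rG; have [y [y0 yn hy]] := cH _ _ rH.
exists (fun s => if s is s'.+1 then y s' else x 0); split => //.
move=> [_|s].
  have xy : x 1 = y 0 by rewrite x1 y0 mid.
  have [h1 h2] := hx 0 isT; rewrite xy in h1 h2; split => // W hW.
  by apply: h2 => e; apply: (hW (inl e)).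
rewrite ltnS => sn; have [h1 h2] := hy s sn; split => // W hW.
by apply: h2 => e; apply: (hW (inr e)).
Qed.

Lemma closed_chain_delta G n col : has_chain G n col -> has_closed_chain (pdelta G) n col.
Proof.
move=> cG V' r; rewrite /compatible /= => /andP[/andP[/eqP io r1] r2].
have [|x [x0 xn hx]] := cG V' r; first by rewrite /compatible r1.
by exists x; rewrite // x0 xn.
Qed.

Lemma closed_chain_mull G H n col : has_closed_chain G n col -> has_closed_chain (pmul G H) n col.
Proof.
move=> cG V' r; rewrite compatible_mul => /and3P[_ rG _].
have [x x0n hx] := cG _ _ rG; exists x => // s sn.
by have [h1 h2] := hx s sn; split => // W hW; apply: h2 => e; apply: (hW (inl e)).
Qed.

End Patterns.

(** * Sums over maps, by kernel and by connected component *)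

Section Kernel.
Variable V : finType.

(** A map with the same fibres as [phi] that depends only on these fibres: a canonical
    representative of the kernel partition. *)
Definition kernel_rep (T : eqType) (phi : V -> T) : {ffun V -> V} :=
  [ffun v => odflt v [pick u | phi u == phi v]].

Lemma kernel_repK (T : eqType) (phi : V -> T) v : phi (kernel_rep phi v) = phi v.
Proof. by rewrite ffunE; case: pickP => [u /eqP|]. Qed.

Lemma eq_kernel_rep (T T' : eqType) (phi : V -> T) (psi : V -> T') :
  (forall u v, (phi u == phi v) = (psi u == psi v)) -> kernel_rep phi = kernel_rep psi.
Proof.
by move=> h; apply/ffunP => v; rewrite !ffunE (eq_pick (fun u => h u v)).
Qed.

Lemma kernel_rep_eq (T : eqType) (phi : V -> T) u v :
  (kernel_rep phi u == kernel_rep phi v) = (phi u == phi v).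
Proof.
apply/eqP/eqP => [h|h]; first by rewrite -(kernel_repK phi u) h kernel_repK.
rewrite !ffunE (eq_pick (Q := fun w => phi w == phi v)) => [|w]; last by rewrite h.
by case: pickP => // /(_ v); rewrite eqxx.
Qed.

Lemma kernel_rep_idem (T : eqType) (phi : V -> T) :
  kernel_rep (kernel_rep phi) = kernel_rep phi.
Proof. by apply: eq_kernel_rep => u v; rewrite kernel_rep_eq. Qed.

Definition quotient_vertex (r : {ffun V -> V}) : finType := {x : V | x \in codom r}.

Definition quotient_map (r : {ffun V -> V}) (v : V) : quotient_vertex r :=
  Sub (r v) (codom_f r v).

Lemma quotient_map_onto r (x : quotient_vertex r) : exists v, quotient_map r v = x.
Proof. by have /codomP[v e] := valP x; exists v; apply/val_inj. Qed.

Lemma quotient_map_eq r u v : (quotient_map r u == quotient_map r v) = (r u == r v).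
Proof. by rewrite -val_eqE. Qed.

Lemma card_quotient_vertex (r : {ffun V -> V}) : ~~ injectiveb r -> #|quotient_vertex r| < #|V|.
Proof.
move=> nr; rewrite card_sub; apply: leq_trans (_ : #|codom r| < #|V|).
  by rewrite ltnS subset_leq_card //; apply/fintype.subsetP => x.
by rewrite ltn_neqAle leq_image_card andbT; apply: contra nr => /image_injP h; apply/injectiveP => u v; exact: h.
Qed.

Definition lift_quotient (T : finType) r (psi : {ffun quotient_vertex r -> T}) : {ffun V -> T} :=
  [ffun v => psi (quotient_map r v)].

(** Every map factors uniquely as an injective map on the quotient by its kernel. *)
Lemma sum_by_kernel (C : nmodType) (T : finType) (Q : pred {ffun V -> T}) (F : {ffun V -> T} -> C) :
  (\sum_(phi | Q phi) F phi = \sum_(r : {ffun V -> V} | kernel_rep r == r)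
    \sum_(psi : {ffun quotient_vertex r -> T} | Q (lift_quotient psi) && injectiveb psi)
      F (lift_quotient psi))%R.
Proof.
rewrite (partition_big (fun phi : {ffun V -> T} => kernel_rep phi) (fun r : {ffun V -> V} => kernel_rep r == r)) /=; last first.
  by move=> phi _; rewrite kernel_rep_idem.
apply: eq_bigr => r /eqP rr.
have rK u : r (r u) = r u by have := kernel_repK r u; rewrite rr.
rewrite (reindex_onto (fun psi => lift_quotient psi)
  (fun phi => [ffun x : quotient_vertex r => phi (val x)])) /=; last first.
  move=> phi /andP[_ /eqP kr]; apply/ffunP => v; rewrite !ffunE /= -{1}kr.
  exact: kernel_repK.
apply: eq_bigl => psi; rewrite -andbA; congr andb.
apply/andP/injectiveP => [[/eqP kr _] x y|inj].
  have [u <-] := quotient_map_onto x; have [v <-] := quotient_map_onto y => e.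
  apply/eqP; rewrite quotient_map_eq -kr kernel_rep_eq !ffunE; exact/eqP.
split.
  apply/eqP; rewrite -[RHS]rr; apply: eq_kernel_rep => u v.
  by rewrite !ffunE (inj_eq inj) quotient_map_eq.
apply/eqP/ffunP => x; rewrite !ffunE; congr (psi _).
have [u <-] := quotient_map_onto x; apply/val_inj; exact: rK.
Qed.

End Kernel.

(** Label classes pull back, with the same boundary edges. *)
Lemma weight_le_quotient (V V' E : finType) (src tgt : E -> V) (r : V -> V') w :
  (forall x, exists v, r v = x) -> weight_le src tgt w ->
  weight_le (fun e => r (src e)) (fun e => r (tgt e)) w.
Proof.
move=> ro hw I lam lo; apply: (hw I (fun v => lam (r v))) => a.
by have [x <-] := lo a; have [v <-] := ro x; exists v.
Qed.

(** A vertex set that no edge crosses splits the graph in two. *)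
Section Split.
Variables (V E : finType) (src tgt : E -> V) (C : {set V}).
Hypothesis closedC : forall e, (src e \in C) = (tgt e \in C).

Definition side_edge (b : bool) : {pred E} := [pred e | (src e \in C) == b].
Definition side_vertex (b : bool) : {pred V} := [pred v | (v \in C) == b].

Definition side_src b (e : {e | e \in side_edge b}) : {v | v \in side_vertex b} :=
  Sub (src (val e)) (valP e).

Fact side_tgt_subproof b (e : {e | e \in side_edge b}) : tgt (val e) \in side_vertex b.
Proof. by have := valP e; rewrite !inE closedC. Qed.

Definition side_tgt b (e : {e | e \in side_edge b}) : {v | v \in side_vertex b} :=
  Sub (tgt (val e)) (side_tgt_subproof e).

(* The cast by [eqxx] keeps track of the side on which [v] lies. *)
Definition side (v : V) : {v | v \in side_vertex true} + {v | v \in side_vertex false} :=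
  (if v \in C as b return (v \in C) == b -> _
   then fun h => inl (Sub v h) else fun h => inr (Sub v h)) (eqxx _).

Definition unside (x : {v | v \in side_vertex true} + {v | v \in side_vertex false}) : V :=
  sum_fun val val x.

Lemma sideK : cancel side unside.
Proof. by move=> v; rewrite /side; move: (eqxx _); case: {2 3}(v \in C). Qed.

Lemma unsideK : cancel unside side.
Proof.
move=> [[v vC]|[v vC]]; rewrite /side /=; move: (eqxx _); case: {2 3}(v \in C) => h.
- by congr inl; apply/val_inj.
- by have := vC; rewrite inE (eqP h).
- by have := vC; rewrite inE (eqP h).
- by congr inr; apply/val_inj.
Qed.

Lemma side_inner_edge (e : {e | e \in side_edge true}) :
  side (src (val e)) = inl (side_src e) /\ side (tgt (val e)) = inl (side_tgt e).
Proof. by split; apply/(can_inj unsideK); rewrite sideK. Qed.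

Lemma side_outer_edge (e : {e | e \in side_edge false}) :
  side (src (val e)) = inr (side_src e) /\ side (tgt (val e)) = inr (side_tgt e).
Proof. by split; apply/(can_inj unsideK); rewrite sideK. Qed.

Lemma sum_side (R : comNzRingType) (T : finType) (k : E -> T -> T -> R) :
  (\sum_(phi : {ffun V -> T}) \prod_e k e (phi (tgt e)) (phi (src e)) =
   (\sum_(phi : {ffun {v | v \in side_vertex true} -> T})
     \prod_e k (val e) (phi (side_tgt e)) (phi (side_src e))) *
   (\sum_(phi : {ffun {v | v \in side_vertex false} -> T})
     \prod_e k (val e) (phi (side_tgt e)) (phi (side_src e))))%R.
Proof.
rewrite (reindex (fun f : {ffun _ + _ -> T} => [ffun v => f (side v)])) /=; last first.
  exists (fun phi : {ffun V -> T} => [ffun x => phi (unside x)]) => f _; apply/ffunP => x; rewrite !ffunE.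
    by rewrite unsideK.
  by rewrite sideK.
rewrite sum_ffun_join big_distrl /=; apply: eq_bigr => f _.
rewrite big_distrr /=; apply: eq_bigr => f' _.
rewrite (bigID (mem (side_edge true))) /=; congr (_ * _)%R.
  rewrite big_sub; apply: eq_bigr => e _; rewrite !ffunE.
  by have [-> ->] := side_inner_edge e.
rewrite (eq_bigl (mem (side_edge false))) => [|e]; last by rewrite !inE; case: (_ \in _).
rewrite big_sub; apply: eq_bigr => e _; rewrite !ffunE.
by have [-> ->] := side_outer_edge e.
Qed.

Definition side_label (I I' : Type) (lam : {v | v \in side_vertex true} -> option I)
    (lam' : {v | v \in side_vertex false} -> option I') (v : V) : option (I + I') :=
  sum_fun (fun x => omap inl (lam x)) (fun x => omap inr (lam' x)) (side v).

Lemma weight_side (I I' : finType) (lam : {v | v \in side_vertex true} -> option I)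
    (lam' : {v | v \in side_vertex false} -> option I') :
  weight src tgt (side_label lam lam') =
  weight (@side_src true) (@side_tgt true) lam + weight (@side_src false) (@side_tgt false) lam'.
Proof.
rewrite /weight big_sumType /=; congr (_ + _); apply: eq_bigr => a _; congr (2 - _);
  rewrite /boundary -!sum1_card.
  rewrite (bigID (mem (side_edge true))) /= [X in _ + X]big1 ?addn0; last first.
    move=> e; rewrite !inE => /andP[ne eN]; exfalso.
    have he : e \in side_edge false by rewrite inE; move: eN; case: (src e \in C).
    have [/= h1 h2] := side_outer_edge (Sub e he); move: ne; rewrite /side_label h1 h2 /=.
    by case: (lam' _) => [?|]; case: (lam' _).
  rewrite (eq_bigl (fun e => (e \in side_edge true) && (e \in [pred e |
    (side_label lam lam' (src e) == Some (inl a)) != (side_label lam lam' (tgt e) == Some (inl a))]))).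
    rewrite big_sub_cond; apply: eq_bigl => e; rewrite !inE /side_label.
    have [-> ->] := side_inner_edge e; rewrite /=.
    by case: (lam _) => [?|]; case: (lam _) => [?|].
  by move=> e; rewrite andbC.
rewrite (bigID (mem (side_edge false))) /= [X in _ + X]big1 ?addn0; last first.
  move=> e; rewrite !inE => /andP[ne eN]; exfalso.
  have he : e \in side_edge true by rewrite inE; move: eN; case: (src e \in C).
  have [/= h1 h2] := side_inner_edge (Sub e he); move: ne; rewrite /side_label h1 h2 /=.
  by case: (lam _) => [?|]; case: (lam _).
rewrite (eq_bigl (fun e => (e \in side_edge false) && (e \in [pred e |
    (side_label lam lam' (src e) == Some (inr a)) != (side_label lam lam' (tgt e) == Some (inr a))]))).
  rewrite big_sub_cond; apply: eq_bigl => e; rewrite !inE /side_label.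
  have [-> ->] := side_outer_edge e; rewrite /=.
  by case: (lam' _) => [?|]; case: (lam' _) => [?|].
by move=> e; rewrite andbC.
Qed.

Lemma side_label_onto (I I' : finType) (lam : {v | v \in side_vertex true} -> option I)
    (lam' : {v | v \in side_vertex false} -> option I') :
  onto_labels lam -> onto_labels lam' -> onto_labels (side_label lam lam').
Proof.
move=> lo lo' [a|a]; [have [x e] := lo a | have [x e] := lo' a]; exists (val x).
  by rewrite /side_label (_ : side (val x) = inl x) /= ?e //; apply/(can_inj unsideK); rewrite sideK.
by rewrite /side_label (_ : side (val x) = inr x) /= ?e //; apply/(can_inj unsideK); rewrite sideK.
Qed.

End Split.

Section ComponentTraces.
Variables (L : nat) (K : Type) (l : 'I_L).

(** Splitting off connected components one by one turns a sum over all maps into a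
    product of traces of graph monomials.  The labellings of the components by their
    two-edge connected components unite into one labelling, which bounds the total
    leaf number. *)
Lemma component_traces n (V E : finType) (src tgt : E -> V) (k : E -> K) w : #|V| <= n ->
  weight_le src tgt w ->
  exists m (g : 'I_m -> graph_monomial L K),
    [/\ forall i, gm_in (g i) = gm_out (g i), forall i e, gm_ell (g i) e = l,
      forall (R : comNzRingType) N (A : 'I_L -> K -> 'M[R]_N),
        (\sum_(phi : {ffun V -> 'I_N}) \prod_e A l (k e) (phi (tgt e)) (phi (src e)) =
        \prod_i \tr (gm_eval A (g i)))%R &
      \sum_i leaf_number (g i) <= w].
Proof.
elim: n V E src tgt k w => [|n IH] V E src tgt k w.
  rewrite leqn0 => /eqP /card0_eq V0 _.
  have VF (v : V) : False by have := V0 v; rewrite inE.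
  have g0 (i : 'I_0) : graph_monomial L K by case: i.
  exists 0, g0; split; [by case | by case | | by rewrite big_ord0].
  move=> R N A; rewrite big_ord0 (big_pred1 (finfun (fun v => match VF v with end))).
    by rewrite big1 // => e; case: (VF (src e)).
  by move=> phi; rewrite /=; symmetry; apply/eqP/ffunP => v; case: (VF v).
have [/card0_eq V0|/card_gt0P[x0 _] Vn hw] := posnP #|V|.
  by move=> _ hw; apply: IH => //; rewrite (eq_card0 V0).
pose G := Digraph src tgt.
pose C : {set V} := [set v | connect (adjacent (G := G) finset.setT) x0 v]%SET.
have cC e : (src e \in C) = (tgt e \in C).
  rewrite !inE; have ce : adjacent (G := G) finset.setT (src e) (tgt e).
    by apply: (@adjacent_edge G); rewrite inE.
  by rewrite (same_connect_r (@adjacent_sym G _) (connect1 ce)).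
pose G1 := Digraph (@side_src V E src C true) (@side_tgt V E src tgt C cC true).
have x0C : x0 \in side_vertex C true by rewrite !inE connect0.
pose x1 : vertex G1 := Sub x0 x0C.
have cG1 : connected_graph (whole_graph G1).
  apply: crossed_connected; first by apply/set0Pn; exists x1; rewrite inE.
  move=> W [[x _ Wx] [y _ Wy]].
  have /existsP[e We] : [exists e, crosses W e]; last by exists e; rewrite // inE.
  apply: contraT; rewrite negb_exists => /forallP nc.
  pose W' (v : V) := if insub v is Some z then W z else false.
  have W'E (z : vertex G1) : W' (val z) = W z by rewrite /W' valK.
  have W'c e : ~~ crosses (G := G) W' e.
    have [eC|eC] := boolP (e \in side_edge src C true).
      by have := nc (Sub e eC); rewrite /crosses -!W'E; exact.
    have sC : (src e \in side_vertex C true) = false by apply/negbTE.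
    have tC : (tgt e \in side_vertex C true) = false by rewrite -[LHS]/((tgt e \in C) == true) -cC.
    by rewrite /crosses /W' /= !insubF.
  have h (z : vertex G1) : W' x0 = W' (val z).
    apply: (@connect_uncrossed G finset.setT) => [e _|]; first exact: W'c.
    by have := valP z; rewrite !inE => /eqP.
  by move: Wy; rewrite -W'E -h (h x) W'E Wx.
pose g0 := @GraphMonomial L K G1 x1 x1 (fun _ => l) (fun e => k (val e)) cG1.
have wsum (I : finType) (lam2 : {v | v \in side_vertex C false} -> option I) :
    onto_labels lam2 ->
    leaf_number G1 + weight (@side_src V E src C false) (@side_tgt V E src tgt C cC false) lam2 <= w.
  move=> lo2; set w2 := weight _ _ _.
  have w2w : w2 <= w.
    pose lam1 (x : {v | v \in side_vertex C true}) : option void := None.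
    have := hw _ (side_label lam1 lam2) (side_label_onto (lam := lam1) _ lo2).
    rewrite (weight_side cC) -/w2 => h; apply: leq_trans (leq_addl _ _) (h _); by case.
  rewrite addnC -leq_subRL //; apply: leaf_number_le => // I1 lam1 lo1.
  rewrite leq_subRL // addnC -(weight_side cC); apply: hw; exact: side_label_onto.
have card2 : #|{: {v | v \in side_vertex C false}}| <= n.
  rewrite card_sub -ltnS; apply: leq_trans Vn; apply: proper_card; apply/properP.
  split; first exact/fintype.subsetP.
  by exists x0; rewrite // !inE connect0.
have hw2 : weight_le (@side_src V E src C false) (@side_tgt V E src tgt C cC false)
    (w - leaf_number G1).
  by move=> I lam lo; rewrite leq_subRL ?wsum //; apply: leq_trans (leq_addr _ _) (wsum _ _ lo).
have [m [g [g1 g2 g3 g4]]] := IH _ _ _ _ (fun e => k (val e)) _ card2 hw2.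
exists m.+1, (fun i => oapp g g0 (unlift ord0 i)); split.
- by move=> i; case: unliftP => [j|] _ /=.
- by move=> i; case: unliftP => [j|] _ /=.
- move=> R N A; rewrite (sum_side cC (fun e => A l (k e))) big_ord_recl unlift_none /=.
  congr (_ * _)%R.
    rewrite [RHS](eq_bigr (fun i => \sum_(phi : {ffun vertex G1 -> 'I_N} | phi x1 == i)
      \prod_(e : edge G1) A l (k (val e)) (phi (side_tgt cC e)) (phi (side_src e)))%R); last first.
      by move=> i _; rewrite mxE; apply: eq_bigl => phi; rewrite /= andbb.
    by rewrite [LHS](partition_big (fun phi : {ffun vertex G1 -> 'I_N} => phi x1) xpredT).
  by rewrite g3; apply: eq_bigr => i _; rewrite liftK.
- rewrite big_ord_recl unlift_none /= (eq_bigr (fun i => leaf_number (g i))) => [|i _]; last by rewrite liftK.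
  rewrite -leq_subRL //; apply: leq_trans (wsum void (fun _ => None) _); first exact: leq_addr.
  by case.
Qed.

End ComponentTraces.

Local Open Scope classical_set_scope.
Local Open Scope ring_scope.
Local Open Scope complex_scope.
Local Open Scope sesquilinear_scope.

(** * Expectations of bounded random variables *)

Section BoundedRV.
Context (R : realType) (d : measure_display) (T : measurableType d).
Variable P : probability T R.
Implicit Types f g : T -> R.

Definition bounded_rv f := measurable_fun setT f /\
  exists M : R, {ae P, forall w, `|f w| <= M}.

Local Notation E f := (Rintegral P setT f).

Lemma bounded_rv_cst c : bounded_rv (fun _ => c).
Proof.
by split; [exact: measurable_cst | exists `|c|; exact: nearW].
Qed.

Lemma bounded_rvD f g : bounded_rv f -> bounded_rv g -> bounded_rv (fun w => f w + g w).
Proof.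
move=> [mf [M hM]] [mg [M' hM']]; split; first exact: measurable_funD.
exists (M + M'); apply: filterS2 hM hM' => w h h'.
exact: le_trans (ler_normD _ _) (lerD h h').
Qed.

Lemma bounded_rvM f g : bounded_rv f -> bounded_rv g -> bounded_rv (fun w => f w * g w).
Proof.
move=> [mf [M hM]] [mg [M' hM']]; split; first exact: measurable_funM.
exists (M * M'); apply: filterS2 hM hM' => w h h'.
by rewrite normrM ler_pM.
Qed.

Lemma bounded_rvN f : bounded_rv f -> bounded_rv (fun w => - f w).
Proof.
move=> [mf [M hM]]; split; first exact: measurable_funN.
by exists M; apply: filterS hM => w; rewrite normrN.
Qed.

Lemma bounded_rvB f g : bounded_rv f -> bounded_rv g -> bounded_rv (fun w => f w - g w).
Proof. by move=> bf bg; apply: bounded_rvD => //; apply: bounded_rvN. Qed.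

Lemma bounded_rv_abs f : bounded_rv f -> bounded_rv (fun w => `|f w|).
Proof.
move=> [mf [M hM]]; split; first exact: measurableT_comp.
by exists M; apply: filterS hM => w; rewrite normr_id.
Qed.

Lemma bounded_rv_sum (I : Type) (s : seq I) (F : I -> T -> R) :
  (forall i, bounded_rv (F i)) -> bounded_rv (fun w => \sum_(i <- s) F i w).
Proof.
move=> bF; elim: s => [|i s IH].
  rewrite (_ : (fun w => _) = fun _ => 0); first exact: bounded_rv_cst.
  by apply/funext => w; rewrite big_nil.
rewrite (_ : (fun w => _) = fun w => F i w + \sum_(i <- s) F i w).
  exact: bounded_rvD.
by apply/funext => w; rewrite big_cons.
Qed.

Lemma bounded_rv_indic (d' : measure_display) (S : measurableType d') (X : T -> S)
    (B : set S) : measurable_fun setT X -> measurable B -> bounded_rv (fun w => \1_B (X w)).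
Proof.
move=> mX mB; split; first by apply: measurableT_comp => //; exact: measurable_indic.
exists 1; apply: nearW => w; rewrite indicE; case: (_ \in _); by rewrite ?normr1 ?normr0.
Qed.

Lemma bounded_rv_integrable f : bounded_rv f -> P.-integrable setT (EFin \o f).
Proof.
move=> [mf [M hM]]; apply/integrableP; split; first exact/measurable_EFinP.
apply: (@le_lt_trans _ _ (`|M|%:E * P setT)%E); last first.
  by rewrite probability_setT mule1 ltry.
apply: integral_le_bound => //; first exact/measurable_EFinP.
by apply: filterS hM => w hw _ /=; rewrite lee_fin (le_trans hw) // ler_norm.
Qed.

Lemma Rexpect_ae f g : measurable_fun setT f -> measurable_fun setT g ->
  {ae P, forall w, f w = g w} -> E f = E g.
Proof.
move=> mf mg fg; congr fine; apply: ae_eq_integral => //; try exact/measurable_EFinP.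
by apply: filterS fg => w -> _.
Qed.

Lemma RexpectD f g : bounded_rv f -> bounded_rv g ->
  E (fun w => f w + g w) = E f + E g.
Proof.
by move=> /bounded_rv_integrable bf /bounded_rv_integrable bg; rewrite -RintegralD.
Qed.

Lemma RexpectB f g : bounded_rv f -> bounded_rv g ->
  E (fun w => f w - g w) = E f - E g.
Proof.
by move=> /bounded_rv_integrable bf /bounded_rv_integrable bg; rewrite -RintegralB.
Qed.

Lemma RexpectZ c f : bounded_rv f -> E (fun w => c * f w) = c * E f.
Proof. by move=> /bounded_rv_integrable bf; rewrite -RintegralZl. Qed.

Lemma Rexpect_cst c : E (fun _ => c) = c.
Proof.
transitivity (c * fine (P setT)); first exact: Rintegral_cst.
by rewrite probability_setT mulr1.
Qed.

Lemma Rexpect_sum (I : Type) (s : seq I) (F : I -> T -> R) :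
  (forall i, bounded_rv (F i)) ->
  E (fun w => \sum_(i <- s) F i w) = \sum_(i <- s) E (F i).
Proof.
move=> bF; elim: s => [|i s IH].
  rewrite big_nil -[RHS](Rexpect_cst 0); apply: eq_Rintegral => w _.
  by rewrite big_nil.
rewrite big_cons -IH -RexpectD //; last exact: bounded_rv_sum.
by apply: eq_Rintegral => w _; rewrite big_cons.
Qed.

Lemma Rexpect_indic (A : set T) : measurable A -> E (\1_A) = fine (P A).
Proof. by move=> mA; rewrite /Rintegral integral_indic // setIT. Qed.

Lemma Rexpect_le f g : bounded_rv f -> bounded_rv g -> (forall w, f w <= g w) ->
  E f <= E g.
Proof.
by move=> /bounded_rv_integrable bf /bounded_rv_integrable bg fg; apply: le_Rintegral.
Qed.

Lemma Rexpect_abs f : bounded_rv f -> `|E f| <= E (fun w => `|f w|).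
Proof. by move=> /bounded_rv_integrable bf; apply: le_normr_Rintegral. Qed.

End BoundedRV.

Section Swap.
Context (R : realType) (d : measure_display) (T : measurableType d).
Variable P : probability T R.
Context (d' : measure_display) (S : measurableType d').
Variables (X X' : T -> S) (mX : measurable_fun setT X) (mX' : measurable_fun setT X').

Local Notation E f := (Rintegral P setT f).
Local Notation bounded_rv := (bounded_rv P).

(** The sum counts the levels (j+1)/m below [t]. *)
Lemma staircase (m : nat) (t : R) : (0 < m)%N -> 0 <= t <= 1 ->
  `|t - m%:R^-1 * \sum_(j < m) ((j.+1%:R <= m%:R * t)%R)%:R| <= m%:R^-1.
Proof.
move=> m0 /andP[t0 t1].
have m0R : 0 < m%:R :> R by rewrite ltr0n.
have tm0 : 0 <= m%:R * t by rewrite mulr_ge0 // ltW.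
have /andP[tr1 tr2] := truncn_itv tm0.
set u := Num.truncn _ in tr1 tr2.
have um : (u <= m)%N.
  by rewrite -(ler_nat R) (le_trans tr1) // ler_piMr // ltW.
have -> : \sum_(j < m) ((j.+1%:R <= m%:R * t)%R)%:R = u%:R :> R.
  rewrite -(big_mkord xpredT (fun j => ((j.+1%:R <= m%:R * t)%R)%:R)) /=.
  rewrite (big_cat_nat (leq0n u) um) /=.
  have -> : \sum_(0 <= j < u) ((j.+1%:R <= m%:R * t)%R)%:R = u%:R :> R.
    rewrite (eq_big_nat _ _ (F2 := fun _ => 1)) ?sumr_const_nat ?subn0 //.
    by move=> j /andP[_ ju]; rewrite (le_trans _ tr1) // ler_nat.
  have -> : \sum_(u <= j < m) ((j.+1%:R <= m%:R * t)%R)%:R = 0 :> R.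
    rewrite (eq_big_nat _ _ (F2 := fun _ => 0)) ?big1 //.
    by move=> j /andP[uj _]; rewrite leNgt (lt_le_trans tr2) // ler_nat.
  by rewrite addr0.
rewrite -(ler_pM2l m0R) divff ?gt_eqF // -[X in X * _]gtr0_norm // -normrM.
rewrite mulrBr mulrA divff ?gt_eqF // mul1r ger0_norm ?subr_ge0 //.
by rewrite lerBlDr -natr1 addrC in tr2 *; exact: ltW.
Qed.

(** Replacing [f] by the staircase below it, an average of the indicators of its upper
    level sets, costs at most 1/m times the first moments of [h] and [h']. *)
Lemma swap_expect01 (h h' : T -> R) (f : S -> R) :
  bounded_rv h -> bounded_rv h' -> measurable_fun setT f ->
  (forall x, 0 <= f x <= 1) ->
  (forall B, measurable B -> E (fun w => h w * \1_B (X w)) = E (fun w => h' w * \1_B (X' w))) ->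
  E (fun w => h w * f (X w)) = E (fun w => h' w * f (X' w)).
Proof.
move=> bh bh' mf f01 hB.
pose B m (j : nat) := f @^-1` `[m%:R^-1 * j.+1%:R, +oo[.
have mB m j : measurable (B m j).
  by rewrite /B -[X in measurable X]setTI; apply: mf => //; exact: measurable_itv.
have approx (h0 : T -> R) (Y : T -> S) : bounded_rv h0 -> measurable_fun setT Y -> forall m, (0 < m)%N ->
   `|E (fun w => h0 w * f (Y w)) - m%:R^-1 * \sum_(j < m) E (fun w => h0 w * \1_(B m j) (Y w))|
    <= m%:R^-1 * E (fun w => `|h0 w|).
  move=> b0 mY m m0.
  have m0R : 0 < m%:R :> R by rewrite ltr0n.
  have bf : bounded_rv (fun w => f (Y w)).
    split; first exact: measurableT_comp.
    by exists 1; apply: nearW => w; have /andP[u v] := f01 (Y w); rewrite ger0_norm.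
  have b1 j : bounded_rv (fun w => \1_(B m j) (Y w)) by exact: bounded_rv_indic.
  have bs : bounded_rv (fun w => \sum_(j < m) (h0 w * \1_(B m j) (Y w))).
    by apply: bounded_rv_sum => j; apply: bounded_rvM.
  rewrite -(Rexpect_sum (P := P)); last by move=> j; apply: bounded_rvM.
  rewrite -(RexpectZ (P := P)) // -RexpectB //; last 2 first.
  - exact: bounded_rvM.
  - by apply: bounded_rvM => //; exact: bounded_rv_cst.
  rewrite -(RexpectZ (P := P)); last exact: bounded_rv_abs.
  have bD : bounded_rv (fun w => h0 w * f (Y w) - m%:R^-1 * (\sum_(j < m) h0 w * \1_(B m j) (Y w))).
    apply: bounded_rvB; first exact: bounded_rvM.
    by apply: bounded_rvM => //; exact: bounded_rv_cst.
  apply: le_trans (Rexpect_abs bD) _; apply: Rexpect_le.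
  - exact: bounded_rv_abs.
  - apply: bounded_rvM; [exact: bounded_rv_cst | exact: bounded_rv_abs].
  move=> w; rewrite -mulr_sumr mulrCA -mulrBr normrM [leRHS]mulrC ler_wpM2l //.
  have := staircase m0 (f01 (Y w)); congr (`| _ - _ * _| <= _).
  apply: eq_bigr => j _; rewrite indicE; congr (_%:R); congr nat_of_bool.
  apply/idP/idP; first by rewrite inE /B /= in_itv /= andbT ler_pdivrMl.
  by rewrite inE /B /= in_itv /= andbT ler_pdivrMl.
apply/eqP; rewrite -subr_eq0 -normr_le0; apply/ler_addgt0Pl => e e0; rewrite addr0.
set C := E (fun w => `|h w|) + E (fun w => `|h' w|).
have C0 : 0 <= C by apply: addr_ge0; apply: Rintegral_ge0.
pose m := (Num.truncn (C / e)).+1.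
have m0 : 0 < m%:R :> R by rewrite ltr0n.
have mC : m%:R^-1 * C <= e.
  by rewrite ler_pdivrMl // -ler_pdivrMr // ltW // truncnS_gt.
have a1 := approx h X bh mX m isT; have a2 := approx h' X' bh' mX' m isT.
rewrite (eq_bigr (fun j : 'I_m => E (fun w => h' w * \1_(B m j) (X' w)))) in a1; last first.
  by move=> j _; apply: hB.
set Z := _ * _ in a1 a2; apply: le_trans mC.
rewrite -[X in `|X|](subrKA Z) mulrDr; apply: le_trans (ler_normD _ _) _.
by apply: lerD => //; rewrite distrC.
Qed.


Definition clip (M x : R) := Num.max (- M) (Num.min M x).

Lemma clip_id M x : `|x| <= M -> clip M x = x.
Proof.
rewrite /clip ler_norml => /andP[h1 h2].
by rewrite (min_idPr h2) (max_idPr h1).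
Qed.

Lemma clip_bound M x : 0 <= M -> `|clip M x| <= M.
Proof.
move=> M0; rewrite /clip ler_norml le_max lexx /= ge_max ge_min lexx /= andbT.
by rewrite (le_trans _ M0) // oppr_le0.
Qed.

(** An almost sure bound on f(X) is enough: clipping [f] changes f(X) on a null set. *)
Lemma swap_expect (h h' : T -> R) (f : S -> R) :
  bounded_rv h -> bounded_rv h' -> measurable_fun setT f ->
  bounded_rv (f \o X) -> bounded_rv (f \o X') ->
  (forall B, measurable B -> E (fun w => h w * \1_B (X w)) = E (fun w => h' w * \1_B (X' w))) ->
  E (fun w => h w * f (X w)) = E (fun w => h' w * f (X' w)).
Proof.
move=> bh bh' mf [mfX [M1 hM1]] [mfX' [M2 hM2]] hB.
pose M := Num.max 1 (Num.max M1 M2).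
have M0 : 0 < M by rewrite /M lt_max ltr01.
pose g x := (clip M (f x) + M) / (M *+ 2).
have mclip : measurable_fun setT (fun x => clip M (f x)).
  apply: measurable_maxr; first exact: measurable_cst.
  by apply: measurable_minr => //; exact: measurable_cst.
have mg : measurable_fun setT g.
  apply: measurable_funM; last exact: measurable_cst.
  by apply: measurable_funD => //; exact: measurable_cst.
have g01 x : 0 <= g x <= 1.
  have := clip_bound (f x) (ltW M0); rewrite ler_norml => /andP[u v].
  rewrite /g divr_ge0 ?mulrn_wge0 ?(ltW M0) //=; last by rewrite -lerBlDr sub0r.
  by rewrite ler_pdivrMr ?pmulrn_lgt0 // mul1r mulr2n lerD2r.
have main (h0 : T -> R) (Y : T -> S) (M' : R) : bounded_rv h0 -> measurable_fun setT Y ->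
   measurable_fun setT (f \o Y) -> M' <= M -> {ae P, forall w, `|(f \o Y) w| <= M'} ->
   E (fun w => h0 w * f (Y w)) = M *+ 2 * E (fun w => h0 w * g (Y w)) - M * E h0.
  move=> b0 mY mfY MM hM'.
  have bg : bounded_rv (fun w => g (Y w)).
    split; first exact: measurableT_comp.
    by exists 1; apply: nearW => w; have /andP[u v] := g01 (Y w); rewrite ger0_norm.
  have bhg : bounded_rv (fun w => h0 w * g (Y w)) by exact: bounded_rvM.
  have bc c : bounded_rv (fun _ => c) by exact: bounded_rv_cst.
  rewrite -(RexpectZ (P := P)) // -(RexpectZ (P := P)) // -RexpectB; try exact: bounded_rvM.
  apply: Rexpect_ae.
  - apply: measurable_funM => //; by case: b0.
  - by have [] := bounded_rvB (bounded_rvM (bc (M *+ 2)) bhg) (bounded_rvM (bc M) b0).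
  apply: filterS hM' => w /= hw; rewrite /g clip_id ?(le_trans hw) //.
  by field; rewrite gt_eqF.
rewrite (main h X M1) ?(main h' X' M2) // /M ?le_max ?lexx ?orbT //.
congr (_ * _ - _ * _); first exact: swap_expect01.
have := hB setT measurableT; congr (_ = _);
  by apply: eq_Rintegral => w _; rewrite indicE in_setT mulr1.
Qed.

End Swap.

Section ComplexRV.
Context (R : realType) (d : measure_display) (T : measurableType d).
Variable P : probability T R.
Implicit Types X Y : T -> R[i].

Definition bounded_crv X := bounded_rv P (fun w => complex.Re (X w)) /\
  bounded_rv P (fun w => complex.Im (X w)).

Lemma Linfty_bounded_rv (f : T -> R) : f \in Lfun P +oo%E -> bounded_rv P f.
Proof.
move=> /andP[/set_mem mf /set_mem b]; split => //.
move: b; rewrite /finite_norm unlock /=; rewrite probability_setT lte01 => hf.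
by have [M hM] := ess_supr_bounded (f := fun w => `|f w|) hf; exists M.
Qed.

Lemma Re_mulc (x y : R[i]) : complex.Re (x * y) =
  complex.Re x * complex.Re y - complex.Im x * complex.Im y.
Proof. by case: x => a b; case: y. Qed.

Lemma Im_mulc (x y : R[i]) : complex.Im (x * y) =
  complex.Re x * complex.Im y + complex.Im x * complex.Re y.
Proof. by case: x => a b; case: y => c e /=; rewrite [b * c]mulrC. Qed.

Lemma Re_addc (x y : R[i]) : complex.Re (x + y) = complex.Re x + complex.Re y.
Proof. by case: x; case: y. Qed.

Lemma Im_addc (x y : R[i]) : complex.Im (x + y) = complex.Im x + complex.Im y.
Proof. by case: x; case: y. Qed.

Lemma bounded_crv_cst c : bounded_crv (fun _ => c).
Proof. by split; exact: bounded_rv_cst. Qed.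

Lemma bounded_crvM X Y : bounded_crv X -> bounded_crv Y -> bounded_crv (fun w => X w * Y w).
Proof.
move=> [X1 X2] [Y1 Y2]; split.
  under eq_fun do rewrite Re_mulc; by apply: bounded_rvB; apply: bounded_rvM.
under eq_fun do rewrite Im_mulc; by apply: bounded_rvD; apply: bounded_rvM.
Qed.

Lemma bounded_crvD X Y : bounded_crv X -> bounded_crv Y -> bounded_crv (fun w => X w + Y w).
Proof.
move=> [X1 X2] [Y1 Y2]; split.
  by under eq_fun do rewrite Re_addc; exact: bounded_rvD.
by under eq_fun do rewrite Im_addc; exact: bounded_rvD.
Qed.

Lemma bounded_crv_prod (I : Type) (s : seq I) (Q : pred I) (F : I -> T -> R[i]) :
  (forall i, bounded_crv (F i)) -> bounded_crv (fun w => \prod_(i <- s | Q i) F i w).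
Proof.
move=> bF; elim: s => [|i s IH].
  by under eq_fun do rewrite big_nil; exact: bounded_crv_cst.
under eq_fun do rewrite big_cons.
by case: (Q i) => //; exact: bounded_crvM.
Qed.

Lemma bounded_crv_sum (I : Type) (s : seq I) (Q : pred I) (F : I -> T -> R[i]) :
  (forall i, bounded_crv (F i)) -> bounded_crv (fun w => \sum_(i <- s | Q i) F i w).
Proof.
move=> bF; elim: s => [|i s IH].
  by under eq_fun do rewrite big_nil; exact: bounded_crv_cst.
under eq_fun do rewrite big_cons.
by case: (Q i) => //; exact: bounded_crvD.
Qed.

Lemma bounded_crv_real (f : T -> R) : bounded_rv P f -> bounded_crv (fun w => (f w)%:C).
Proof. by move=> bf; split => //=; exact: bounded_rv_cst. Qed.

Local Notation E := (expectc P).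

Lemma eq_expectc X Y : X =1 Y -> E X = E Y.
Proof. by move=> /funext ->. Qed.

Lemma expectc_ae X Y : bounded_crv X -> bounded_crv Y ->
  {ae P, forall w, X w = Y w} -> E X = E Y.
Proof.
move=> [[X1 _] [X2 _]] [[Y1 _] [Y2 _]] XY; rewrite /expectc.
by congr (_ +i* _); apply: Rexpect_ae => //; apply: filterS XY => w ->.
Qed.

Lemma expectcD X Y : bounded_crv X -> bounded_crv Y -> E (fun w => X w + Y w) = E X + E Y.
Proof.
move=> [X1 X2] [Y1 Y2]; rewrite /expectc.
under eq_fun do rewrite Re_addc; under [X in _ +i* Rintegral _ _ X]eq_fun do rewrite Im_addc.
by rewrite !RexpectD.
Qed.

Lemma expectcM X Y : bounded_crv X -> bounded_crv Y -> E (fun w => X w * Y w) =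
  (Rintegral P setT (fun w => complex.Re (X w) * complex.Re (Y w)) -
   Rintegral P setT (fun w => complex.Im (X w) * complex.Im (Y w))) +i*
  (Rintegral P setT (fun w => complex.Re (X w) * complex.Im (Y w)) +
   Rintegral P setT (fun w => complex.Im (X w) * complex.Re (Y w))).
Proof.
move=> [X1 X2] [Y1 Y2]; rewrite /expectc.
under eq_fun do rewrite Re_mulc; under [X in _ +i* Rintegral _ _ X]eq_fun do rewrite Im_mulc.
by rewrite RexpectB ?RexpectD //; exact: bounded_rvM.
Qed.

Lemma expectc_cst c : E (fun _ => c) = c.
Proof. by rewrite /expectc !Rexpect_cst; case: c. Qed.

Lemma expectcZ c X : bounded_crv X -> E (fun w => c * X w) = c * E X.
Proof.
move=> [X1 X2]; rewrite (expectcM (bounded_crv_cst c)) // !RexpectZ //.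
by case: c => a b; rewrite /expectc; congr (_ +i* _); rewrite /= [b * _ ]mulrC.
Qed.

Lemma expectc_sum (I : Type) (s : seq I) (Q : pred I) (F : I -> T -> R[i]) :
  (forall i, bounded_crv (F i)) ->
  E (fun w => \sum_(i <- s | Q i) F i w) = \sum_(i <- s | Q i) E (F i).
Proof.
move=> bF; elim: s => [|i s IH].
  rewrite big_nil -[RHS](expectc_cst 0); apply: eq_expectc => w; by rewrite big_nil.
rewrite big_cons -IH; under eq_expectc do rewrite big_cons.
by case: (Q i) => //; rewrite -expectcD //; exact: bounded_crv_sum.
Qed.

Lemma expectc_real (f : T -> R) : E (fun w => (f w)%:C) = (Rintegral P setT f)%:C.
Proof. by rewrite /expectc /= Rexpect_cst. Qed.

Lemma expectc_indic (A : set T) : measurable A -> E (fun w => (\1_A w)%:C) = (fine (P A))%:C.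
Proof. by move=> mA; rewrite expectc_real Rexpect_indic. Qed.

Section SwapC.
Context (d' : measure_display) (S : measurableType d').
Variables (X X' : T -> S) (mX : measurable_fun setT X) (mX' : measurable_fun setT X').

(** The expectation of h f(X) depends only on the complex measure B |-> E[h 1_B(X)].
    With h' constant this is independence, with h = h' = 1 equality of laws. *)
Lemma swap_expectc (h h' : T -> R[i]) (f : S -> R[i]) :
  bounded_crv h -> bounded_crv h' ->
  measurable_fun setT (fun x => complex.Re (f x)) ->
  measurable_fun setT (fun x => complex.Im (f x)) ->
  bounded_crv (f \o X) -> bounded_crv (f \o X') ->
  (forall B, measurable B ->
     E (fun w => h w * (\1_B (X w))%:C) = E (fun w => h' w * (\1_B (X' w))%:C)) ->
  E (fun w => h w * f (X w)) = E (fun w => h' w * f (X' w)).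
Proof.
move=> bh bh' mf1 mf2 bf bf' hB.
have hB' B : measurable B ->
  Rintegral P setT (fun w => complex.Re (h w) * \1_B (X w)) =
  Rintegral P setT (fun w => complex.Re (h' w) * \1_B (X' w)) /\
  Rintegral P setT (fun w => complex.Im (h w) * \1_B (X w)) =
  Rintegral P setT (fun w => complex.Im (h' w) * \1_B (X' w)).
  move=> mB; have := hB B mB.
  rewrite (expectcM bh (bounded_crv_real (bounded_rv_indic P mX mB))).
  rewrite (expectcM bh' (bounded_crv_real (bounded_rv_indic P mX' mB))) /=.
  have z (u : T -> R) : Rintegral P setT (fun w => u w * 0) = 0.
    by rewrite -[RHS](Rexpect_cst P); apply: eq_Rintegral => w _; rewrite mulr0.
  by rewrite !z !subr0 !add0r => -[].
have [bh1 bh2] := bh; have [bh1' bh2'] := bh'.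
have [bf1 bf2] := bf; have [bf1' bf2'] := bf'.
rewrite (expectcM bh bf) (expectcM bh' bf') /=.
have sw u v := swap_expect (P := P) mX mX' (h := u) (h' := v).
rewrite (sw _ _ _ bh1 bh1' mf1 bf1 bf1' (fun B mB => (hB' B mB).1)).
rewrite (sw _ _ _ bh2 bh2' mf2 bf2 bf2' (fun B mB => (hB' B mB).2)).
rewrite (sw _ _ _ bh1 bh1' mf2 bf2 bf2' (fun B mB => (hB' B mB).1)).
by rewrite (sw _ _ _ bh2 bh2' mf1 bf1 bf1' (fun B mB => (hB' B mB).2)).
Qed.

End SwapC.
End ComplexRV.

(** * Independence and permutation invariance of moments *)

(** The alias carries the pointed structure that generated sigma-algebras require. *)
Definition mxfamily (R : realType) (N : nat) (K : Type) := K -> 'M[R[i]]_N.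
HB.instance Definition _ R N K := Choice.on (mxfamily R N K).
HB.instance Definition _ R N K := isPointed.Build (mxfamily R N K) (fun _ => 0).

Section ComplexMeasurable.
Context (R : realType) (d : measure_display) (T : measurableType d).

Definition cmeasurable (f : T -> R[i]) :=
  measurable_fun setT (fun x => complex.Re (f x)) /\
  measurable_fun setT (fun x => complex.Im (f x)).

Lemma cmeasurableM f g : cmeasurable f -> cmeasurable g -> cmeasurable (fun x => f x * g x).
Proof.
move=> [f1 f2] [g1 g2]; split; cbv beta.
  by under eq_fun do rewrite Re_mulc; apply: measurable_funB; apply: measurable_funM.
by under eq_fun do rewrite Im_mulc; apply: measurable_funD; apply: measurable_funM.
Qed.

Lemma cmeasurable_prod (I : Type) (s : seq I) (Q : pred I) (F : I -> T -> R[i]) :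
  (forall i, cmeasurable (F i)) -> cmeasurable (fun w => \prod_(i <- s | Q i) F i w).
Proof.
move=> mF; elim: s => [|i s IH].
  by split; cbv beta; under eq_fun do rewrite big_nil; exact: measurable_cst.
rewrite (_ : (fun w => _) = fun w => if Q i then F i w * \prod_(i <- s | Q i) F i w
    else \prod_(i <- s | Q i) F i w).
  by case: (Q i) => //; exact: cmeasurableM.
by apply/funext => w; rewrite big_cons.
Qed.
End ComplexMeasurable.

Section FamilySpace.
Context (R : realType) (N : nat) (K : Type).
Local Notation S := (@g_sigma_algebraType (mxfamily R N K) (@coordinate_sets R N K)).

Lemma cmeasurable_entry k (i j : 'I_N) : cmeasurable (fun x : S => x k i j).
Proof.
split=> _ U mU; rewrite setTI; apply: sub_sigma_algebra; exists k, i, j, U; split => //.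
- by left.
- by right.
Qed.

Context (d : measure_display) (T : measurableType d).

Lemma measurable_family (A : K -> T -> 'M[R[i]]_N) :
  (forall k i j, cmeasurable (fun w => A k w i j)) ->
  measurable_fun setT (fun w => (fun k => A k w) : S).
Proof.
move=> mA; apply: (@measurability _ _ T S setT _ (@coordinate_sets R N K)) => // _ [_ [k [i [j [U [mU [->|->]]]]]] <-];
  rewrite setTI.
- have [m _] := mA k i j; rewrite -[X in measurable X]setTI; exact: m.
- have [_ m] := mA k i j; rewrite -[X in measurable X]setTI; exact: m.
Qed.

End FamilySpace.

Section Independence.
Context (R : realType) (N L : nat) (K : Type).
Context (d : measure_display) (T : measurableType d) (P : probability T R).
Variable A : 'I_L -> K -> T -> 'M[R[i]]_N.
Hypothesis mA : forall l k i j, cmeasurable (fun w => A l k w i j).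
Hypothesis indA : independent_families P A.
Local Notation S := (@g_sigma_algebraType (mxfamily R N K) (@coordinate_sets R N K)).
Variable f : 'I_L -> S -> R[i].
Local Notation fam l w := ((fun k => A l k w) : S).
Hypothesis mf : forall l, cmeasurable (f l).
Hypothesis bf : forall l, bounded_crv P (fun w => f l (fam l w)).

Let mfam l : measurable_fun setT (fun w => fam l w).
Proof. exact: measurable_family. Qed.

Let mev l (B : set S) : measurable B -> measurable (family_event (A l) B).
Proof.
by move=> mB; rewrite -[X in measurable X]setTI; exact: (mfam l measurableT mB).
Qed.

Let bind l (B : set S) : measurable B -> bounded_crv P (fun w => (\1_B (fam l w))%:C).
Proof. by move=> mB; apply: bounded_crv_real; exact: bounded_rv_indic. Qed.

(** Indicators are replaced by functions one colour at a time: when all other factors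
    are fixed, both sides are measures in the event of that colour. *)
Lemma expect_prod_indic (s : seq 'I_L) (J : {set 'I_L}) (B : 'I_L -> set S) : uniq s ->
  (forall l, l \in s -> l \notin J) -> (forall l, measurable (B l)) ->
  expectc P (fun w => \prod_(l <- s) f l (fam l w) * \prod_(l in J) (\1_(B l) (fam l w))%:C) =
  \prod_(l <- s) expectc P (fun w => f l (fam l w)) *
    \prod_(l in J) (fine (P (family_event (A l) (B l))))%:C.
Proof.
elim: s J B => [|l s IH] J B.
  move=> _ _ mB; rewrite big_nil mul1r.
  have mI : measurable (\bigcap_(l in [set` J]) family_event (A l) (B l)).
    by apply: fin_bigcap_measurable => // l _; by apply: mev.
  rewrite -(rmorph_prod (real_complex R)) /=.
  have -> : \prod_(l in J) fine (P (family_event (A l) (B l))) =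
     fine (P (\bigcap_(l in [set` J]) family_event (A l) (B l))).
    rewrite indA // (_ : (\prod_(l in J) _)%E =
       (\prod_(l in J) fine (P (family_event (A l) (B l))))%:E) //.
    elim/big_rec2: _ => // l x y lJ ->; rewrite EFinM fineK //.
    by apply: fin_num_measure; apply: mev.
  rewrite -expectc_indic //; apply: eq_expectc => w; rewrite big_nil mul1r.
  rewrite -(rmorph_prod (real_complex R)) /=; congr (_%:C).
  rewrite indicE; case: (boolP (w \in _)) => wI.
    rewrite big1 // => l lJ; rewrite indicE mem_set //.
    by move/set_mem: wI => /(_ l lJ).
  have /existsP[l /andP[lJ nl]] : [exists l, (l \in J) && (fam l w \notin B l)].
    apply: contraT; rewrite negb_exists => /forallP h; move: wI.
    rewrite mem_set // => l lJ; apply/set_mem; have := h l.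
    by rewrite (lJ : l \in J) /= negbK.
  by rewrite (bigD1 l) //= indicE (negbTE nl) mul0r.
move=> /= /andP[ls us] sJ mB.
pose h w := \prod_(l <- s) f l (fam l w) * \prod_(l in J) (\1_(B l) (fam l w))%:C.
have bh : bounded_crv P h.
  apply: bounded_crvM; first exact: bounded_crv_prod.
  by apply: bounded_crv_prod => l'; exact: bind.
set c := \prod_(l <- s) expectc P (fun w => f l (fam l w)) *
    \prod_(l in J) (fine (P (family_event (A l) (B l))))%:C.
have [mf1 mf2] := mf l.
transitivity (expectc P (fun w => h w * f l (fam l w))).
  by apply: eq_expectc => w; rewrite big_cons /h -mulrA mulrC.
rewrite (swap_expectc (mfam l) (mfam l) bh (bounded_crv_cst P c) mf1 mf2 (bf l) (bf l)); last first.
  move=> B0 mB0.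
  rewrite (expectcZ c (bind l mB0)).
  have -> : expectc P (fun w => (\1_B0 (fam l w))%:C) = (fine (P (family_event (A l) B0)))%:C.
    by rewrite -expectc_indic //; by apply: mev.
  have lJ : l \notin J by apply: sJ; rewrite inE eqxx.
  pose B' l' := if l' == l then B0 else B l'.
  have eJ l' : l' \in J -> B' l' = B l'.
    by move=> l'J; rewrite /B'; case: eqVneq => // ll; rewrite -ll l'J in lJ.
  have sJ' l' : l' \in s -> l' \notin (l |: J)%SET.
    move=> l's; rewrite !inE negb_or sJ ?inE ?l's ?orbT // andbT.
    by apply: contraNneq ls => <-.
  have mB' l' : measurable (B' l') by rewrite /B'; case: ifP.
  have := IH (l |: J)%SET B' us sJ' mB'.
  have eB' : B' l = B0 by rewrite /B' eqxx.
  rewrite big_setU1 //= eB'.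
  have -> : \prod_(l' in J) (fine (P (family_event (A l') (B' l'))))%:C =
      \prod_(l' in J) (fine (P (family_event (A l') (B l'))))%:C.
    by apply: eq_bigr => l' l'J; rewrite eJ.
  rewrite mulrCA -/c mulrC => <-.
  apply: eq_expectc => w; rewrite big_setU1 //= eB' /h -mulrA; congr (_ * _).
  by rewrite mulrC; congr (_ * _); apply: eq_bigr => l' l'J; rewrite eJ.
transitivity (c * expectc P (fun w => f l (fam l w))); first exact: (expectcZ c (bf l)).
by rewrite big_cons /c mulrC mulrA.
Qed.

Lemma expect_prod_independent :
  expectc P (fun w => \prod_l f l (fam l w)) = \prod_l expectc P (fun w => f l (fam l w)).
Proof.
have := @expect_prod_indic (index_enum 'I_L) finset.set0 (fun _ => setT) (index_enum_uniq _).
rewrite big_set0 mulr1 => <- //; last by move=> l _; rewrite inE.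
by apply: eq_expectc => w; rewrite big_set0 mulr1.
Qed.

End Independence.

Section PermutationInvariance.
Context (R : realType) (N : nat) (K : Type).
Context (d : measure_display) (T : measurableType d) (P : probability T R).
Variable A : K -> T -> 'M[R[i]]_N.
Hypothesis mA : forall k i j, cmeasurable (fun w => A k w i j).
Hypothesis invA : permutation_invariant P A.
Local Notation S := (@g_sigma_algebraType (mxfamily R N K) (@coordinate_sets R N K)).

Lemma conj_perm_mxE (C : comUnitRingType) (s : 'S_N) (M : 'M[C]_N) i j :
  (perm_mx s *m M *m invmx (perm_mx s)) i j = M (s i) (s j).
Proof.
have -> : invmx (perm_mx s) = perm_mx s^-1 :> 'M[C]_N.
  apply: (can_inj (mulKmx (unitmx_perm C s))).
  by rewrite mulmxV ?unitmx_perm // -perm_mxM mulgV perm_mx1.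
by rewrite -row_permE -col_permE !mxE.
Qed.

Lemma expect_permuted (s : 'S_N) (f : S -> R[i]) : cmeasurable f ->
  bounded_crv P (fun w => f (fun k => A k w)) ->
  bounded_crv P (fun w => f (fun k => \matrix_(i, j) A k w (s i) (s j))) ->
  expectc P (fun w => f (fun k => A k w)) =
  expectc P (fun w => f (fun k => \matrix_(i, j) A k w (s i) (s j))).
Proof.
move=> [mf1 mf2] bf bf'.
have m1 := measurable_family mA.
have m2 : measurable_fun setT (fun w => (fun k => \matrix_(i, j) A k w (s i) (s j)) : S).
  apply: (@measurable_family R N K _ T (fun k w => \matrix_(i, j) A k w (s i) (s j))) => k i j.
  have := mA k (s i) (s j); congr cmeasurable; apply/funext => w; by rewrite mxE.
have b1 := bounded_crv_cst P (1 : R[i]).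
have := swap_expectc m1 m2 b1 b1 mf1 mf2 bf bf'.
move=> swap; transitivity (expectc P (fun w => 1 * f (fun k => A k w))).
  by apply: eq_expectc => w; rewrite mul1r.
transitivity (expectc P (fun w => 1 * f (fun k => \matrix_(i, j) A k w (s i) (s j)))); last first.
  by apply: eq_expectc => w; rewrite mul1r.
apply: swap => B mB.
have ev (A' : K -> T -> 'M[R[i]]_N) : measurable_fun setT (fun w => (fun k => A' k w) : S) ->
    expectc P (fun w => 1 * (\1_B (fun k => A' k w))%:C) = (fine (P (family_event A' B)))%:C.
  move=> mA'; under eq_expectc do rewrite mul1r.
  rewrite -expectc_indic // -[X in measurable X]setTI; exact: mA'.
rewrite (ev A m1) (ev (fun k w => \matrix_(i, j) A k w (s i) (s j)) m2) (invA s mB).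
congr ((fine (P _))%:C); rewrite /family_event; apply/funext => w /=; congr B.
by apply/funext => k; apply/matrixP => i j; rewrite conj_perm_mxE mxE.
Qed.

End PermutationInvariance.

(** * Growth of moments *)

(** List the values of each injection, followed by the missing indices, and match the
    two lists. *)
Lemma extend_injection_perm (V : finType) N (phi psi : {ffun V -> 'I_N}) :
  injective phi -> injective psi -> exists s : 'S_N, forall v, s (phi v) = psi v.
Proof.
move=> ip iq.
pose rest (f : {ffun V -> 'I_N}) := [seq x <- enum 'I_N | x \notin codom f].
pose full (f : {ffun V -> 'I_N}) := codom f ++ rest f.
have cu (f : {ffun V -> 'I_N}) : injective f -> uniq (codom f) by move=> inf; rewrite map_inj_uniq // enum_uniq.
have fu (f : {ffun V -> 'I_N}) : injective f -> uniq (full f).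
  move=> inf; rewrite cat_uniq cu // filter_uniq ?enum_uniq // andbT /=.
  by apply/hasPn => x; rewrite mem_filter => /andP[].
have fin f x : x \in full f.
  by rewrite mem_cat mem_filter mem_enum andbT; case: (x \in codom f).
have fs (f : {ffun V -> 'I_N}) : injective f -> size (full f) = N.
  move=> inf; rewrite -[RHS]card_ord cardE; apply/perm_size/uniq_perm; rewrite ?fu ?enum_uniq //.
  by move=> x; rewrite fin mem_enum.
pose s x := nth x (full psi) (index x (full phi)).
have idx x : (index x (full phi) < N)%N by rewrite -[X in (_ < X)%N](fs phi ip) index_mem.
have sinj : injective s.
  move=> x y; rewrite /s (set_nth_default y) ?fs // => /eqP.
  rewrite nth_uniq ?fs ?fu // => /eqP ixy.
  by rewrite -[x](nth_index x (fin phi x)) ixy (set_nth_default y) ?fs // nth_index.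
exists (perm sinj) => v; rewrite permE /s.
have vi : (index v (enum V) < #|V|)%N by rewrite cardE index_mem mem_enum.
have -> : index (phi v) (full phi) = index v (enum V).
  by rewrite index_cat codom_f /codom /image_mem index_map.
rewrite nth_cat size_codom vi /codom /image_mem (nth_map v) -?cardE //.
by rewrite nth_index // mem_enum.
Qed.

(** The least bound on the weights is attained, since weights are at most 2|V|. *)
Lemma maximal_weight (V E : finType) (src tgt : E -> V) : exists w,
  weight_le src tgt w /\
  exists (I : finType) (lam : V -> option I), onto_labels lam /\ weight src tgt lam = w.
Proof.
have bound : weight_le src tgt (2 * #|V|).
  move=> I lam lo; apply: (@leq_trans (2 * #|I|)%N).
    rewrite mulnC -sum_nat_const; apply: leq_sum => x _; exact: leq_subr.
  rewrite leq_mul2l /=; have /choice[h hE] := lo.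
  by apply: (@leq_card _ _ h) => x y xy; have := hE x; rewrite xy hE => -[].
move: bound; elim: (2 * #|V|)%N => [|w IH] hw.
  exists 0; split => //; exists void, (fun _ => None); split; first by case.
  by rewrite /weight big_pred0 //; case.
have [/IH //|nw] := pselect (weight_le src tgt w).
exists w.+1; split => //; apply: contrapT => nmax; apply: nw => I lam lo.
have := hw I lam lo; rewrite leq_eqVlt ltnS => /orP[/eqP e|//].
by case: nmax; exists I, lam.
Qed.

Section Order.
Variable R : realType.
Implicit Types u v : nat -> R[i].
Local Notation nc := (@Normc.normc R).
Local Notation q N := (Num.sqrt N%:R : R).

(** u N = O(N^(a/2)); powers of the square root keep the exponents natural numbers. *)
Definition order_le u (a : nat) := exists (C : R) (N0 : nat),
  forall N, (N0 <= N)%N -> nc (u N) <= C * q N ^+ a.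

Lemma nc_ge0 (x : R[i]) : 0 <= nc x.
Proof. by case: x => a b; exact: sqrtr_ge0. Qed.

Lemma nc_add (x y : R[i]) : nc (x + y) <= nc x + nc y.
Proof. exact: le_normcD. Qed.

Lemma nc_opp (x : R[i]) : nc (- x) = nc x.
Proof. exact: normcN. Qed.

Lemma nc_mul (x y : R[i]) : nc (x * y) = nc x * nc y.
Proof. exact: Normc.normcM. Qed.

Lemma nc_real (x : R) : nc x%:C = `|x|.
Proof. by rewrite /Normc.normc /= expr0n /= addr0 sqrtr_sqr. Qed.

Lemma nc_nat (n : nat) : nc n%:R = n%:R.
Proof.
have -> : n%:R = (n%:R : R)%:C :> R[i] by rewrite (rmorph_nat (real_complex R)).
by rewrite nc_real ger0_norm.
Qed.

Lemma nc_prod (I : Type) (s : seq I) (F : I -> R[i]) :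
  nc (\prod_(i <- s) F i) = \prod_(i <- s) nc (F i).
Proof.
elim: s => [|i s IH]; first by rewrite !big_nil; exact: (nc_nat 1).
by rewrite !big_cons nc_mul IH.
Qed.

Lemma q_ge1 N : (0 < N)%N -> 1 <= q N.
Proof. by move=> N0; rewrite -[leLHS]sqrtr1 ler_sqrt ?ler1n ?ltr0n. Qed.

Lemma order_le_trans u a b : (a <= b)%N -> order_le u a -> order_le u b.
Proof.
move=> ab [C [N0 h]]; exists `|C|, (maxn N0 1) => N.
rewrite geq_max => /andP[h0 h1]; apply: le_trans (h N h0) _.
apply: le_trans (_ : `|C| * q N ^+ a <= _).
  by rewrite ler_wpM2r ?ler_norm // exprn_ge0 // sqrtr_ge0.
by rewrite ler_wpM2l // ler_weXn2l // q_ge1.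
Qed.

Lemma order_leD u v a : order_le u a -> order_le v a -> order_le (fun N => u N + v N) a.
Proof.
move=> [C [N0 h]] [C' [N1 h']]; exists (C + C'), (maxn N0 N1) => N.
rewrite geq_max => /andP[h0 h1]; rewrite mulrDl.
exact: le_trans (nc_add _ _) (lerD (h _ h0) (h' _ h1)).
Qed.

Lemma order_leN u a : order_le u a -> order_le (fun N => - u N) a.
Proof. by move=> [C [N0 h]]; exists C, N0 => N h0; rewrite nc_opp h. Qed.

Lemma order_le0 a : order_le (fun _ => 0) a.
Proof. by exists 0, 0 => N _; rewrite mul0r -[0 : R[i]]/(0%:C) nc_real normr0. Qed.

Lemma order_le_sum (I : Type) (s : seq I) (Q : pred I) (F : I -> nat -> R[i]) a :
  (forall i, Q i -> order_le (F i) a) -> order_le (fun N => \sum_(i <- s | Q i) F i N) a.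
Proof.
move=> hF; elim: s => [|i s IH].
  by under [X in order_le X _]eq_fun do rewrite big_nil; exact: order_le0.
under [X in order_le X _]eq_fun do rewrite big_cons.
by have := hF i; case: (Q i) => // /(_ isT) hi; apply: order_leD.
Qed.

End Order.

Section Growth.
Context (R : realType) (L : nat) (K : Type)
    (disp : nat -> measure_display)
    (T : forall N : nat, measurableType (disp N))
    (P : forall N : nat, probability (T N) R)
    (A : forall N : nat, 'I_L -> K -> T N -> 'M[R[i]]_N).
Arguments A : clear implicits.
Hypothesis A_bounded : forall N l k, Linfty_mx (P N) (A N l k).
Hypothesis A_indep : forall N, independent_families (P N) (A N).
Hypothesis A_perm : forall N, exists l0 : 'I_L, forall l, l != l0 ->
       permutation_invariant (P N) (A N l).
Hypothesis A_growth : forall (l : 'I_L) (m : nat) (g : 'I_m -> graph_monomial L K),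
       (1 <= m)%N ->
       (forall i, gm_in (g i) = gm_out (g i)) ->
       (forall i e, gm_ell (g i) e = l) ->
       (fun N : nat => Normc.normc (expectc (P N) (fun w =>
          \prod_(i < m) \tr (gm_eval (fun l' k => A N l' k w) (g i)))) : R^o)
       =O_\oo
       (fun N : nat =>
          N%:R `^ ((\sum_(i < m) leaf_number (g i))%N%:R / 2%:R) : R^o).

Local Notation nc := (@Normc.normc R).
Local Notation q N := (Num.sqrt N%:R : R).

Lemma entry_bounded N l k i j : bounded_crv (P N) (fun w => A N l k w i j).
Proof.
have [h1 h2] := @A_bounded N l k i j; split; exact: Linfty_bounded_rv.
Qed.

Lemma entry_cmeasurable N l k i j : cmeasurable (fun w => A N l k w i j).
Proof. by have [[h1 _] [h2 _]] := entry_bounded l k i j. Qed.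

Definition moment N (V E : finType) (src tgt : E -> V) (c : E -> 'I_L) (k : E -> K)
    (phi : V -> 'I_N) : R[i] :=
  expectc (P N) (fun w => \prod_e A N (c e) (k e) w (phi (tgt e)) (phi (src e))).

Lemma moment_bounded N (V E : finType) (src tgt : E -> V) c k (phi : V -> 'I_N) :
  bounded_crv (P N) (fun w => \prod_e A N (c e) (k e) w (phi (tgt e)) (phi (src e))).
Proof. by apply: bounded_crv_prod => e; exact: entry_bounded. Qed.

Lemma trace_order (l : 'I_L) m (g : 'I_m -> graph_monomial L K) w :
  (forall i, gm_in (g i) = gm_out (g i)) -> (forall i e, gm_ell (g i) e = l) ->
  (\sum_i leaf_number (g i) <= w)%N ->
  order_le (fun N => expectc (P N) (fun w =>
    \prod_i \tr (gm_eval (fun l' k => A N l' k w) (g i)))) w.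
Proof.
move=> g1 g2 gw; apply: order_le_trans gw _.
case: m g g1 g2 => [|m] g g1 g2.
  exists 1, 0 => N _; under eq_expectc do rewrite big_ord0.
  by rewrite big_ord0 expr0 mulr1 expectc_cst (nc_nat R 1).
have /eqO_exP[C C0 [N0 _ h]] := A_growth (isT : (1 <= m.+1)%N) g1 g2.
exists C, N0 => N N0N; have := h N N0N; rewrite /= ger0_norm ?nc_ge0 //.
move/le_trans; apply; rewrite ler_wpM2l ?(ltW C0) //.
rewrite ger0_norm ?powR_ge0 // mulrC powRrM powR_mulrn ?powR_ge0 //.
by rewrite powR12_sqrt.
Qed.

Lemma sum_moment_order (l : 'I_L) (V E : finType) (src tgt : E -> V) (k : E -> K) w :
  weight_le src tgt w ->
  order_le (fun N => \sum_(phi : {ffun V -> 'I_N}) moment src tgt (fun _ => l) k phi) w.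
Proof.
move=> hw; have [m [g [g1 g2 g3 g4]]] := component_traces l k (leqnn _) hw.
have [C [N0 h]] := trace_order g1 g2 g4; exists C, N0 => N N0N.
have := h N N0N; congr (nc _ <= _).
rewrite /moment -expectc_sum; last by move=> phi; exact: moment_bounded.
by apply: eq_expectc => x; rewrite (g3 _ _ (fun l' k => A N l' k x)).
Qed.

Definition injective_sum N (V E : finType) (src tgt : E -> V) (c : E -> 'I_L) (k : E -> K) :=
  \sum_(phi : {ffun V -> 'I_N} | injectiveb phi) moment src tgt c k phi.

Lemma moment_lift N (V E : finType) (src tgt : E -> V) c k (r : {ffun V -> V})
    (psi : {ffun quotient_vertex r -> 'I_N}) :
  moment src tgt c k (lift_quotient psi) =
  moment (fun e => quotient_map r (src e)) (fun e => quotient_map r (tgt e)) c k psi.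
Proof.
by apply: eq_expectc => w; apply: eq_bigr => e _; rewrite !ffunE.
Qed.

(** Moebius inversion on the partitions of the vertex set, as an induction on the number
    of vertices: the full sum exceeds the injective one by injective sums on proper
    quotients, which satisfy the same weight bound. *)
Lemma injective_sum_order (l : 'I_L) (V E : finType) (src tgt : E -> V) (k : E -> K) w :
  weight_le src tgt w ->
  order_le (fun N => injective_sum N src tgt (fun _ => l) k) w.
Proof.
have [n] := ubnP #|V|; elim: n V src tgt => // n IH V src tgt; rewrite ltnS => Vn hw.
have e N : injective_sum N src tgt (fun _ => l) k =
   \sum_(phi : {ffun V -> 'I_N}) moment src tgt (fun _ => l) k phi
   - \sum_(r : {ffun V -> V} | (kernel_rep r == r) && ~~ injectiveb r)
       injective_sum N (fun e => quotient_map r (src e)) (fun e => quotient_map r (tgt e))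
         (fun _ => l) k.
  apply: (canRL (addrK _)).
  rewrite [RHS](bigID (fun phi : {ffun V -> 'I_N} => injectiveb phi)) /=; congr (_ + _).
  rewrite [RHS](sum_by_kernel (fun phi : {ffun V -> 'I_N} => ~~ injectiveb phi)).
  rewrite [LHS]big_mkcondr; apply: eq_bigr => r _; symmetry.
  have li (psi : {ffun quotient_vertex r -> 'I_N}) : injectiveb psi ->
     injectiveb (lift_quotient psi) = injectiveb r.
    move=> /injectiveP ip; apply/injectiveP/injectiveP => h u v.
      move=> ruv; apply: h; rewrite !ffunE; congr (psi _); apply/eqP.
      by rewrite quotient_map_eq ruv.
    by rewrite !ffunE => /ip /eqP; rewrite quotient_map_eq => /eqP /h.
  case: ifP => nr.
    apply: eq_big => psi; last by rewrite moment_lift.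
    by case: (boolP (injectiveb psi)) => [/li ->|]; rewrite ?nr ?andbF.
  rewrite big_pred0 // => psi.
  by case: (boolP (injectiveb psi)) => [/li ->|]; rewrite ?nr ?andbF.
have -> : (fun N => injective_sum N src tgt (fun _ => l) k) = _ := funext e.
apply: order_leD; first exact: sum_moment_order.
apply: order_leN; apply: order_le_sum => r /andP[_ nr]; apply: IH.
  exact: leq_trans (card_quotient_vertex nr) Vn.
by apply: weight_le_quotient hw => x; exact: quotient_map_onto.
Qed.

Definition colour_moment N (V E : finType) (src tgt : E -> V) (c : E -> 'I_L) (k : E -> K)
    (l : 'I_L) (phi : V -> 'I_N) :=
  moment (fun e : {e | e \in colour_class c l} => src (val e))
         (fun e : {e | e \in colour_class c l} => tgt (val e))
         (fun _ => l) (fun e => k (val e)) phi.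

Lemma moment_independent N (V E : finType) (src tgt : E -> V) c k (phi : V -> 'I_N) :
  moment src tgt c k phi = \prod_l colour_moment src tgt c k l phi.
Proof.
pose f l (x : mxfamily R N K) : R[i] :=
  \prod_(e : {e | e \in colour_class c l}) x (k (val e)) (phi (tgt (val e))) (phi (src (val e))).
have mf l : cmeasurable (f l : @g_sigma_algebraType (mxfamily R N K) (@coordinate_sets R N K) -> _).
  by apply: cmeasurable_prod => e; exact: cmeasurable_entry.
have bf l : bounded_crv (P N) (fun w => f l (fun k => A N l k w)).
  by apply: bounded_crv_prod => e; exact: entry_bounded.
have := expect_prod_independent (fun l k i j => entry_cmeasurable l k i j) (@A_indep N) mf bf.
rewrite /colour_moment /moment => <-; apply: eq_expectc => w.
rewrite (partition_big c xpredT) //=; apply: eq_bigr => l _.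
rewrite /f -(big_sub (colour_class c l) (fun e => A N l (k e) w (phi (tgt e)) (phi (src e)))).
by apply: eq_bigr => e /eqP ->.
Qed.

(** A permutation of the indices carries one injection to the other. *)
Lemma moment_invariant N (l : 'I_L) (V E : finType) (src tgt : E -> V) k (phi psi : {ffun V -> 'I_N}) :
  permutation_invariant (P N) (A N l) -> injective phi -> injective psi ->
  moment src tgt (fun _ : E => l) k phi = moment src tgt (fun _ => l) k psi.
Proof.
move=> inv ip iq; have [s hs] := extend_injection_perm ip iq.
pose f (x : mxfamily R N K) : R[i] := \prod_e x (k e) (phi (tgt e)) (phi (src e)).
have mf : cmeasurable (f : @g_sigma_algebraType (mxfamily R N K) (@coordinate_sets R N K) -> _).
  by apply: cmeasurable_prod => e; exact: cmeasurable_entry.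
have fE w : f (fun k => \matrix_(i, j) A N l k w (s i) (s j)) =
    \prod_e A N l (k e) w (psi (tgt e)) (psi (src e)).
  by apply: eq_bigr => e _; rewrite mxE !hs.
have bf' : bounded_crv (P N) (fun w => f (fun k => \matrix_(i, j) A N l k w (s i) (s j))).
  by under [X in bounded_crv _ X]eq_fun do rewrite fE; exact: moment_bounded.
have := expect_permuted (fun k i j => entry_cmeasurable l k i j) inv mf
  (moment_bounded src tgt (fun _ => l) k phi) bf'.
by rewrite /moment => h; rewrite [LHS]h; apply: eq_expectc => w; rewrite fE.
Qed.

(** For all colours but one, permutation invariance makes the moment constant on
    injective maps, hence equal to the average of the injective sum. *)
Lemma injective_sum_factor N (V E : finType) (src tgt : E -> V) c k :
  (N ^_ #|V|)%:R ^+ L.-1 * injective_sum N src tgt c k =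
  \prod_l injective_sum N (fun e : {e | e \in colour_class c l} => src (val e))
         (fun e : {e | e \in colour_class c l} => tgt (val e)) (fun _ => l) (fun e => k (val e)).
Proof.
have [l0 hl0] := A_perm N.
pose S l := injective_sum N (fun e : {e | e \in colour_class c l} => src (val e))
         (fun e : {e | e \in colour_class c l} => tgt (val e)) (fun _ => l) (fun e => k (val e)).
have SE l (phi : {ffun V -> 'I_N}) : l != l0 -> injectiveb phi ->
    (N ^_ #|V|)%:R * colour_moment src tgt c k l phi = S l.
  move=> ll /injectiveP ip.
  have e : forall psi : {ffun V -> 'I_N}, injectiveb psi ->
     colour_moment src tgt c k l psi = colour_moment src tgt c k l phi.
    by move=> psi /injectiveP iq; rewrite /colour_moment; apply: moment_invariant => //; exact: hl0.
  rewrite /S /injective_sum (eq_bigr _ e).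
  rewrite (eq_bigl (mem [pred psi : {ffun V -> 'I_N} | injectiveb psi])) //.
  by rewrite sumr_const mulr_natl; have := card_inj_ffuns V 'I_N; rewrite cardsE card_ord => ->.
rewrite -/(\prod_l S l) (bigD1 l0) //= {1}/S /injective_sum big_distrl big_distrr /=.
apply: eq_bigr => phi ip; rewrite moment_independent (bigD1 l0) //= mulrCA; congr (_ * _).
rewrite -(eq_bigr _ (fun l ll => SE l phi ll ip)) big_split /=; congr (_ * _).
rewrite (eq_bigl (mem (predC1 l0))) //.
by rewrite prodr_const cardC1 card_ord.
Qed.

Lemma ffact_half m N : (2 * m <= N)%N -> ((N%:R / 2) ^+ m <= (N ^_ m)%:R :> R).
Proof.
move=> mN; have : (m <= m)%N by []; elim: {-2}m => [|j IH] jm; first by rewrite expr0.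
rewrite exprSr ffactnSr natrM; apply: ler_pM; rewrite ?exprn_ge0 ?divr_ge0 //.
  by apply: IH; exact: ltnW.
rewrite ler_pdivrMr // -natrM ler_nat; lia.
Qed.

(** With w_l the maximal weight of the graph of colour l, the injective sum is of order
    half the sum of the w_l, minus |V| for each colour but one. *)
Lemma injective_sum_small (V E : finType) (src tgt : E -> V) (c : E -> 'I_L) (k : E -> K)
    n (x : nat -> V) (col : nat -> 'I_L) :
  (forall W : pred V, (exists v, W v) -> (exists v, ~~ W v) -> (2 <= boundary src tgt W)%N) ->
  (0 < n)%N -> x 0 = x n ->
  (forall s, (s < n)%N -> x s != x s.+1) ->
  (forall s, (s.+1 < n)%N -> col s != col s.+1) ->
  (forall s, (s < n)%N -> forall W : pred V,
    (forall e, c e = col s -> W (src e) = W (tgt e)) -> W (x s) = W (x s.+1)) ->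
  order_le (fun N => injective_sum N src tgt c k) 1.
Proof.
move=> cut n0 x0n xs cs xc.
have key l : exists z : nat * {I : finType & V -> option I},
    [/\ weight_le (fun e : {e | e \in colour_class c l} => src (val e))
         (fun e : {e | e \in colour_class c l} => tgt (val e)) z.1,
      onto_labels (projT2 z.2) &
      weight (fun e : {e | e \in colour_class c l} => src (val e))
         (fun e : {e | e \in colour_class c l} => tgt (val e)) (projT2 z.2) = z.1].
  have [w [h [I [lam [lo lw]]]]] := maximal_weight
    (fun e : {e | e \in colour_class c l} => src (val e))
    (fun e : {e | e \in colour_class c l} => tgt (val e)).
  by exists (w, existT _ I lam).
have [z hz] := choice key.
have zb : (\sum_l (z l).1 <= 2 * (L.-1 * #|V|) + 1)%N.
  have lo l : onto_labels (projT2 (z l).2) by have [] := hz l.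
  have := exponent_bound lo cut n0 x0n xs cs xc.
  by congr (_ <= _)%N; apply: eq_bigr => l _; have [] := hz l.
have ord l := injective_sum_order l (fun e : {e | e \in colour_class c l} => k (val e))
  (let: And3 h _ _ := hz l in h).
have [C hC] := choice ord.
have [N0 hN] := choice hC.
pose m := #|V|.
exists (\prod_l `|C l| * (2 ^+ m) ^+ L.-1), (maxn (2 * m) (maxn 1 (\max_l N0 l))) => N.
rewrite !geq_max => /and3P[mN N1 /bigmax_leqP N0N].
have q0 : 0 < q N by apply: lt_le_trans (q_ge1 R N1).
have := congr1 nc (injective_sum_factor N src tgt c k).
rewrite nc_mul nc_prod.
have -> : nc ((N ^_ m)%:R ^+ L.-1) = (N ^_ m)%:R ^+ L.-1.
  by rewrite -natrX nc_nat natrX.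
set J := nc _ => e.
have up : (N ^_ m)%:R ^+ L.-1 * J <= \prod_l `|C l| * q N ^+ (2 * (L.-1 * m) + 1).
  rewrite e; apply: le_trans (_ : \prod_l (`|C l| * q N ^+ (z l).1) <= _).
    apply: ler_prod => l _; rewrite nc_ge0 /=; apply: le_trans (hN l N (N0N l isT)) _.
    by rewrite ler_wpM2r ?ler_norm // exprn_ge0 // ltW.
  rewrite big_split /= prodrXr ler_wpM2l //; first by apply: prodr_ge0 => l _.
  by rewrite ler_weXn2l // q_ge1.
have low : (q N ^+ 2 / 2) ^+ m <= (N ^_ m)%:R.
  by rewrite sqr_sqrtr // ffact_half.
rewrite expr1.
have Q0 : 0 < (q N ^+ 2) ^+ (L.-1 * m) by rewrite !exprn_gt0.
rewrite -(ler_pM2l Q0).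
have J0 : 0 <= J by exact: nc_ge0.
have low' : (q N ^+ 2) ^+ (L.-1 * m) <= (2 ^+ m) ^+ L.-1 * (N ^_ m)%:R ^+ L.-1.
  rewrite mulnC exprM -exprMn; apply: lerXn2r; rewrite ?nnegrE ?mulr_ge0 ?exprn_ge0 ?(ltW q0) //.
  by move: low; rewrite expr_div_n ler_pdivrMr ?exprn_gt0 // mulrC.
apply: le_trans (ler_wpM2r J0 low') _.
rewrite -mulrA; apply: le_trans (ler_wpM2l _ up) _; first by rewrite !exprn_ge0.
rewrite le_eqVlt; apply/orP; left; apply/eqP.
rewrite exprD expr1 (exprM (q N)).
set a := (2 ^+ m) ^+ L.-1; set b := _ ^+ (L.-1 * m); ring.
Qed.

(** The two-edge connectivity and the closed chain of a pattern pass to the quotient by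
    every kernel compatible with its constraints. *)
Lemma pattern_trace_small (G : pattern L K) n (col : nat -> 'I_L) :
  (0 < n)%N -> (forall s, (s.+1 < n)%N -> col s != col s.+1) ->
  tec_pattern G -> has_closed_chain (pdelta G) n col ->
  order_le (fun N => expectc (P N) (fun w => \tr (peval (fun l k => A N l k w) G))) 1.
Proof.
move=> n0 cs tG chG.
have e N : expectc (P N) (fun w => \tr (peval (fun l k => A N l k w) G)) =
   \sum_(r : {ffun pvertex G -> pvertex G} | (kernel_rep r == r) &&
       compatible (G := pdelta G) (quotient_map r))
     injective_sum N (fun e => quotient_map r (psrc e)) (fun e => quotient_map r (ptgt e))
       (@pcol _ _ G) (@pkey _ _ G).
  transitivity (\sum_(phi : {ffun pvertex G -> 'I_N} | compatible (G := pdelta G) phi)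
      moment (@psrc _ _ G) (@ptgt _ _ G) (@pcol _ _ G) (@pkey _ _ G) phi).
    rewrite -expectc_sum; last by move=> phi; exact: moment_bounded.
    by apply: eq_expectc => w; rewrite peval_trace.
  rewrite sum_by_kernel [RHS]big_mkcondr; apply: eq_bigr => r _.
  have cl (psi : {ffun quotient_vertex r -> 'I_N}) : injectiveb psi ->
     compatible (G := pdelta G) (lift_quotient psi) = compatible (G := pdelta G) (quotient_map r).
    move=> /injectiveP ip; congr andb; apply: eq_all => p; rewrite !ffunE.
      by rewrite (inj_eq ip).
    by rewrite (inj_eq ip).
  case: ifP => cr.
    apply: eq_big => psi; last by rewrite moment_lift.
    by case: (boolP (injectiveb psi)) => [/cl ->|]; rewrite ?cr ?andbF.
  rewrite big_pred0 // => psi.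
  by case: (boolP (injectiveb psi)) => [/cl ->|]; rewrite ?cr ?andbF.
have -> := funext e.
apply: order_le_sum => r /andP[_ cr].
have [x x0n hx] := chG _ _ cr.
apply: (@injective_sum_small _ _ _ _ _ _ n x col) => //.
- move=> W [v Wv] [v' Wv'].
  have sat : saturated (G := pdelta G) (fun u => W (quotient_map r u)).
    by move: cr => /andP[+ _]; apply: sub_all => p /eqP ->.
  have [u uv] := quotient_map_onto v; have [u' uv'] := quotient_map_onto v'.
  have := tG (fun u => W (quotient_map r u)) _ _ _.
  move: sat => /= /andP[/eqP io sG] /(_ sG); rewrite io eqxx addn0; apply.
    by exists u; rewrite uv.
  by exists u'; rewrite uv'.
- by move=> s /hx[].
- by move=> s /hx[].
Qed.

End Growth.

(** * The pattern of the error term *)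

Section PowerTrace.
Variables (R : realType) (N : nat).

Definition sqnorm (z : R[i]) : R := complex.Re z ^+ 2 + complex.Im z ^+ 2.

Lemma sqnorm_ge0 z : 0 <= sqnorm z.
Proof. by rewrite addr_ge0 // sqr_ge0. Qed.

Lemma mul_conjc (z : R[i]) : z * conjc z = (sqnorm z)%:C.
Proof.
by case: z => a b; rewrite /sqnorm /=; apply/eqP; rewrite eq_complex /=; apply/andP;
  split; apply/eqP; ring.
Qed.

(** The spectral basis of a diagonal matrix only mixes equal eigenvalues, so it also
    diagonalises every function of the matrix. *)
Lemma psd_powR_diag (a : 'rV[R[i]]_N) p : diag_mx a \is normalmx ->
  psd_powR (diag_mx a) p = diag_mx (map_mx (fun z => (complex.Re z `^ p)%:C) a).
Proof.
move=> /orthomx_spectralP; rewrite /psd_powR.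
set U := spectralmx _; set s := spectral_diag _ => e.
have uU : U \in unitmx by exact: spectral_unit.
have {}e : U *m diag_mx a = diag_mx s *m U by rewrite [diag_mx a]e !mulmxA mulmxV // mul1mx.
set h := fun z => _.
have eh : U *m diag_mx (map_mx h a) = diag_mx (map_mx h s) *m U.
  apply/matrixP => i j; have := congr1 (fun M : 'M[R[i]]_N => M i j) e.
  rewrite !mul_mx_diag !mul_diag_mx !mxE => eij.
  have [->|nz] := eqVneq (U i j) 0; first by rewrite mul0r mulr0.
  have -> : a 0 j = s 0 i by apply: (mulfI nz); rewrite eij mulrC.
  by rewrite mulrC.
by rewrite -mulmxA -eh mulmxA mulVmx // mul1mx.
Qed.

Lemma trace_psd_powR (X : 'M[R[i]]_N) p :
  \tr (psd_powR (mxdelta X *m (mxdelta X)^t* ) p) = (\sum_i sqnorm (X i i) `^ p)%:C.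
Proof.
pose a : 'rV[R[i]]_N := \row_i (sqnorm (X i i))%:C.
have e : mxdelta X *m (mxdelta X)^t* = diag_mx a.
  apply/matrixP => i j; rewrite !mxE (bigD1 i) //= big1 ?addr0 => [|k ki]; last first.
    by rewrite !mxE eq_sym (negbTE ki) mulr0n mul0r.
  rewrite !mxE eqxx mulr1n eq_sym; have [->|ij] := eqVneq i j.
    by rewrite !mulr1n -mul_conjc.
  by rewrite !mulr0n rmorph0 mulr0.
rewrite e psd_powR_diag.
  rewrite mxtrace_diag (rmorph_sum (real_complex R)) /=.
  by apply: eq_bigr => i _; rewrite !mxE.
have -> : diag_mx a \is normalmx = (diag_mx a *m (diag_mx a)^t* == (diag_mx a)^t* *m diag_mx a) by [].
suff -> : (diag_mx a)^t* = diag_mx a by [].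
apply/matrixP => i j; rewrite !mxE eq_sym; have [->|ij] := eqVneq i j.
  by rewrite !mulr1n; exact: conjc_real.
by rewrite !mulr0n; exact: conjc0.
Qed.

End PowerTrace.

Lemma powR_le_exprD (R : realType) (x p : R) (m : nat) : 0 <= x -> (0 < m)%N ->
  m%:R <= p <= m.+1%:R -> x `^ p <= x ^+ m + x ^+ m.+1.
Proof.
move=> x0 m0 /andP[mp pm].
have [->|xn0] := eqVneq x 0.
  rewrite powR0 ?addr_ge0 ?exprn_ge0 // gt_eqF // (lt_le_trans _ mp) // ltr0n //.
have xp : 0 < x by rewrite lt_def xn0.
have [x1|x1] := leP 1 x.
  apply: le_trans (ler_powR x1 pm) _.
  by rewrite powR_mulrn // lerDr exprn_ge0.
apply: (@le_trans _ _ (x `^ m%:R)); first by apply: ger_powR; rewrite // xp ltW.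
by rewrite powR_mulrn // lerDl exprn_ge0.
Qed.

Section Products.
Variables (L : nat) (K : Type).

Definition represents (G : pattern L K)
    (M : forall (C : comNzRingType) N, ('I_L -> K -> 'M[C]_N) -> 'M[C]_N) :=
  forall (C : comNzRingType) N (A : 'I_L -> K -> 'M[C]_N), peval A G = M C N A.

Lemma product_pattern (l : 'I_L) n
    (M : 'I_n -> forall (C : comNzRingType) N, ('I_L -> K -> 'M[C]_N) -> 'M[C]_N) :
  (forall i, exists G, [/\ represents G (M i), tec_pattern G & coloured_link l G]) ->
  exists G, [/\ represents G (fun C N A => \big[mulmx/1%:M]_(i < n) M i C N A),
    tec_pattern G & coloured_link l G].
Proof.
elim: n M => [|n IH] M hM.
  exists (pone L K); split; [|exact: tec_one|exact: link_one].
  by move=> C N A; rewrite big_ord0 peval_one.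
have [G [rG tG lG]] := hM ord0.
have [H [rH tH lH]] := IH _ (fun i => hM (lift ord0 i)).
exists (pmul G H); split; [|exact: tec_mul|exact: link_mul].
by move=> C N A; rewrite big_ord_recl peval_mul rG rH.
Qed.

Lemma monomial_pattern (l : 'I_L) n (k : 'I_n -> K) (g : 'I_n.+1 -> graph_monomial L K) :
  (forall j, cactus_type (g j)) ->
  exists G, [/\ represents G (fun C N A => nc_monomial_eval (fun j => gm_eval A (g j)) k (A l)),
    tec_pattern G & coloured_link l G].
Proof.
move=> hg.
have [|G [rG tG lG]] := product_pattern (l := l)
  (M := fun j C N A => A l (k j) *m gm_eval A (g (lift ord0 j))).
  move=> j; exists (pmul (pletter l (k j)) (pmonomial (g (lift ord0 j)))); split.
  - by move=> C N A; rewrite peval_mul peval_letter peval_monomial.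
  - by apply: tec_mul; [exact: tec_letter | exact: tec_monomial].
  - by apply: link_mul; [exact: link_letter | exact: link_monomial].
exists (pmul (pmonomial (g ord0)) G); split.
- by move=> C N A; rewrite peval_mul peval_monomial rG.
- by apply: tec_mul => //; exact: tec_monomial.
- by apply: link_mul => //; exact: link_monomial.
Qed.

(** Each centred factor is a step of the chain, along its own colour; [l0] is only a
    value for the indices beyond [n]. *)
Lemma chain_pattern (l0 : 'I_L) n (ell : 'I_n -> 'I_L)
    (M : 'I_n -> forall (C : comNzRingType) N, ('I_L -> K -> 'M[C]_N) -> 'M[C]_N) :
  (forall i, exists G, [/\ represents G (M i), tec_pattern G & coloured_link (ell i) G]) ->
  exists G col, [/\ represents G
      (fun C N A => \big[mulmx/1%:M]_(i < n) (M i C N A - mxdelta (M i C N A))),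
    tec_pattern G, has_chain G n col & forall i : 'I_n, col i = ell i].
Proof.
elim: n ell M => [|n IH] ell M hM.
  exists (pone L K), (fun _ => l0); split; [|exact: tec_one|exact: chain_one|by case].
  by move=> C N A; rewrite big_ord0 peval_one.
have [G [rG tG lG]] := hM ord0.
have [H [col [rH tH cH eH]]] := IH (fun i => ell (lift ord0 i)) _ (fun i => hM (lift ord0 i)).
exists (pmul (poffdiag G) H), (fun s => if s is s'.+1 then col s' else ell ord0); split.
- by move=> C N A; rewrite big_ord_recl peval_mul peval_offdiag rG rH.
- by apply: tec_mul => //; exact: tec_offdiag.
- by apply: chain_mul => //; exact: chain_offdiag.
- move=> i; case: (unliftP ord0 i) => [j|] ->; last by [].
  by rewrite lift0 eH.
Qed.

Lemma closed_chain_deltaW (G : pattern L K) n col :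
  has_closed_chain G n col -> has_closed_chain (pdelta G) n col.
Proof.
move=> cG V' r; rewrite /compatible /= => /andP[/andP[_ r1] r2].
by have [|x x0 hx] := cG V' r; [rewrite /compatible r1 | exists x].
Qed.

End Products.

Section Conjugation.
Context (R : realType) (L : nat) (K : Type)
    (disp : nat -> measure_display)
    (T : forall N : nat, measurableType (disp N))
    (P : forall N : nat, probability (T N) R)
    (A : forall N : nat, 'I_L -> K -> T N -> 'M[R[i]]_N).
Arguments A : clear implicits.
Hypothesis A_conj : forall l, conj_stable P (fun N => A N l).

(** The pattern has finitely many edges, so that the exceptional null sets can be
    collected. *)
Lemma conj_pattern (G : pattern L K) : tec_pattern G -> exists G', tec_pattern G' /\
  forall N, {ae P N, forall w, peval (fun l k => A N l k w) G' =
    map_mx (@conjc R) (peval (fun l k => A N l k w) G)}.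
Proof.
move=> tG.
have key (e : pedge G) : exists z : K * bool, forall N, {ae P N, forall w, forall i j,
    A N (pcol e) z.1 w (if z.2 then j else i) (if z.2 then i else j) =
    conjc (A N (pcol e) (pkey e) w i j)}.
  have [k' [hk|hk]] := A_conj (pcol e) (pkey e).
    exists (k', false) => N; apply: filterS (hk N) => w /= -> i j; by rewrite mxE.
  exists (k', true) => N; apply: filterS (hk N) => w /= -> i j; by rewrite !mxE.
have [z hz] := choice key.
exists (prelabel (fun e => (z e).1) (fun e => (z e).2)); split; first exact: tec_relabel.
move=> N; have : {ae P N, forall w, forall e : pedge G, forall i j,
    A N (pcol e) (z e).1 w (if (z e).2 then j else i) (if (z e).2 then i else j) =
    conjc (A N (pcol e) (pkey e) w i j)}.
  by apply: filter_forall => e; exact: hz.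
apply: filterS => w hw; apply/matrixP => i j; rewrite !mxE (rmorph_sum (@conjc R)).
apply: eq_bigr => phi _; rewrite /pweight (rmorph_prod (@conjc R)).
by apply: eq_bigr => e _ /=; rewrite -hw; case: (z e).2.
Qed.

(** Products of diagonal matrices multiply entrywise: alternate the diagonal part of the
    pattern with its conjugate.  The closed chain of the first factor survives. *)
Lemma modulus_pattern (G : pattern L K) n col m : tec_pattern G -> has_closed_chain (pdelta G) n col ->
  exists G', [/\ tec_pattern G', has_closed_chain (pdelta G') n col &
    forall N, {ae P N, forall w, peval (fun l k => A N l k w) G' =
      \matrix_(i, j) (((sqnorm (peval (fun l k => A N l k w) G i i))%:C ^+ m.+1) *+ (i == j))}].
Proof.
move=> tG cG; have tD := tec_delta tG.
have [H [tH hH]] := conj_pattern tD.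
elim: m => [|m [G' [tG' cG' hG']]].
  exists (pmul (pdelta G) H); split; first exact: tec_mul.
    by apply: closed_chain_deltaW; exact: closed_chain_mull.
  move=> N; apply: filterS (hH N) => w hw; apply/matrixP => i j.
  rewrite peval_mul hw peval_delta !mxE (bigD1 i) //= big1 ?addr0 => [|k ki]; last first.
    by rewrite !mxE eq_sym (negbTE ki) mulr0n mul0r.
  rewrite !mxE eqxx mulr1n expr1; have [->|ij] := eqVneq i j.
    by rewrite !mulr1n mul_conjc.
  by rewrite !mulr0n conjc0 mulr0.
exists (pmul (pmul (pdelta G) H) G'); split; first by apply: tec_mul => //; exact: tec_mul.
  by apply: closed_chain_deltaW; do 2 apply: closed_chain_mull.
move=> N; apply: filterS2 (hH N) (hG' N) => w hw hw'; apply/matrixP => i j.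
rewrite !peval_mul hw hw' peval_delta !mxE (bigD1 i) //= big1 ?addr0 => [|k ki]; last first.
  rewrite !mxE big1 ?mul0r // => k' _; rewrite !mxE.
  have [e1|] := eqVneq i k'; last by rewrite mulr0n mul0r.
  by rewrite -e1 eq_sym (negbTE ki) mulr0n conjc0 mulr0.
rewrite !mxE (bigD1 i) //= big1 ?addr0 => [|k ki]; last first.
  by rewrite !mxE eq_sym (negbTE ki) mulr0n mul0r.
by rewrite !mxE eqxx !mulr1n mul_conjc mulrnAr -exprS.
Qed.

End Conjugation.

(** * Convergence in Schatten norm *)

Section PatternEntries.
Context (R : realType) (L : nat) (K : Type) (N : nat)
  (d : measure_display) (T : measurableType d) (P : probability T R).
Variable A : 'I_L -> K -> T -> 'M[R[i]]_N.
Hypothesis bA : forall l k i j, bounded_crv P (fun w => A l k w i j).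
Variable G : pattern L K.
Local Notation X w := (peval (fun l k => A l k w) G).

Lemma peval_bounded i j : bounded_crv P (fun w => X w i j).
Proof.
under [F in bounded_crv _ F]eq_fun do rewrite mxE.
apply: bounded_crv_sum => phi; apply: bounded_crv_prod => e; exact: bA.
Qed.

Lemma sqnorm_bounded i : bounded_rv P (fun w => sqnorm (X w i i)).
Proof.
have [h1 h2] := peval_bounded i i; rewrite /sqnorm.
apply: bounded_rvD; under [F in bounded_rv _ F]eq_fun do rewrite expr2; exact: bounded_rvM.
Qed.

Lemma sqnorm_expr_bounded i m : bounded_rv P (fun w => sqnorm (X w i i) ^+ m).
Proof.
elim: m => [|m IH].
  by under [F in bounded_rv _ F]eq_fun do rewrite expr0; exact: bounded_rv_cst.
under [F in bounded_rv _ F]eq_fun do rewrite exprS.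
by apply: bounded_rvM => //; exact: sqnorm_bounded.
Qed.

End PatternEntries.

Lemma inv_sqrt_small (R : realType) (c e : R) (N : nat) : 0 <= c -> 0 < e ->
  (Num.truncn ((c / e) ^+ 2) < N)%N -> N%:R^-1 * (c * Num.sqrt N%:R) <= e.
Proof.
move=> c0 e0 hN.
have N0 : 0 < N%:R :> R by rewrite ltr0n; apply: leq_ltn_trans hN.
have cN : (c / e) ^+ 2 <= N%:R.
  by apply: ltW; apply: lt_le_trans (truncnS_gt _) _; rewrite ler_nat.
have q0 : 0 < Num.sqrt N%:R :> R by rewrite sqrtr_gt0.
have ceq : c <= e * Num.sqrt N%:R.
  rewrite mulrC -ler_pdivrMr // -[leLHS]ger0_norm ?divr_ge0 ?(ltW e0) //.
  by rewrite -sqrtr_sqr ler_wsqrtr.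
rewrite ler_pdivrMl // -[X in X * e](sqr_sqrtr (ltW N0)).
by rewrite expr2 -mulrA [c * _]mulrC ler_pM2l // [Num.sqrt _ * e]mulrC.
Qed.

Theorem proposition2p3
    (R : realType) (L : nat) (hL : (1 <= L)%N) (K : Type)
    (disp : nat -> measure_display)
    (T : forall N : nat, measurableType (disp N))
    (P : forall N : nat, probability (T N) R)
    (A : forall N : nat, 'I_L -> K -> T N -> 'M[R[i]]_N)
    (A_bounded : forall N l k, Linfty_mx (P N) (A N l k))
    (A_conj : forall l, conj_stable P (fun N => A N l))
    (A_indep : forall N, independent_families (P N) (A N))
    (A_perm : forall N, exists l0 : 'I_L, forall l, l != l0 ->
       permutation_invariant (P N) (A N l))
    (A_growth : forall (l : 'I_L) (m : nat) (g : 'I_m -> graph_monomial L K),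
       (1 <= m)%N ->
       (forall i, gm_in (g i) = gm_out (g i)) ->
       (forall i e, gm_ell (g i) e = l) ->
       (fun N : nat => Normc.normc (expectc (P N) (fun w =>
          \prod_(i < m) \tr (gm_eval (fun l' k => A N l' k w) (g i)))) : R^o)
       =O_\oo
       (fun N : nat =>
          N%:R `^ ((\sum_(i < m) leaf_number (g i))%N%:R / 2%:R) : R^o))
    (n : nat) (hn : (2 <= n)%N)
    (ell : 'I_n -> 'I_L)
    (ell_alt : forall i j : 'I_n, j = i.+1 :> nat -> ell i != ell j)
    (d : 'I_n -> nat)
    (k : forall i : 'I_n, 'I_(d i) -> K)
    (g : forall i : 'I_n, 'I_(d i).+1 -> graph_monomial L K)
    (g_cactus : forall i j, cactus_type (g i j)) :
  let PA (N : nat) (w : T N) (i : 'I_n) : 'M[R[i]]_N :=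
    nc_monomial_eval
      (fun j => gm_eval (fun l k' => A N l k' w) (g i j)) (k i)
      (fun k' => A N (ell i) k' w) in
  let eps (N : nat) (w : T N) : 'M[R[i]]_N :=
    mxdelta (\big[mulmx/1%:M]_(i < n) (PA N w i - mxdelta (PA N w i))) in
  forall p : R, 1 <= p ->
    (fun N : nat => Normc.normc (expectc (P N) (fun w =>
       N%:R^-1 * \tr (psd_powR (eps N w *m (eps N w)^t*) p))))
    @ \oo --> (0 : R).
Proof.
move=> PA eps p p1.
have [G [col [rG tG cG colE]]] := chain_pattern (Ordinal hL) (ell := ell)
  (fun i => monomial_pattern (ell i) (k i) (g_cactus i)).
have ccG := closed_chain_delta cG.
pose AA N (w : T N) : 'I_L -> K -> 'M[R[i]]_N := fun l k => A N l k w.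
pose x N (w : T N) i := sqnorm (peval (AA N w) G i i).
have epsE N w : eps N w = mxdelta (peval (AA N w) G) by rewrite rG.
have bA N := fun l k i j => entry_bounded A_bounded (N := N) l k i j.
have bx N i m : bounded_rv (P N) (fun w => x N w i ^+ m).
  exact: sqnorm_expr_bounded.
have bS N m : bounded_rv (P N) (fun w => \sum_i x N w i ^+ m).
  by apply: bounded_rv_sum => i; exact: bx.
have alt s : (s.+1 < n)%N -> col s != col s.+1.
  move=> sn; have := colE (Ordinal (ltnW sn)); have := colE (Ordinal sn) => /= -> ->.
  exact: ell_alt.
have small m : exists (C : R) N0, forall N, (N0 <= N)%N ->
    Rintegral (P N) setT (fun w => \sum_i x N w i ^+ m.+1) <= C * Num.sqrt N%:R.
  have [G' [tG' cG' hG']] := modulus_pattern A_conj m tG ccG.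
  have [C [N0 hN]] := pattern_trace_small A_bounded A_indep A_perm A_growth
    (ltnW hn) alt tG' cG'.
  exists C, N0 => N N0N; have := hN N N0N; rewrite expr1; apply: le_trans.
  have -> : expectc (P N) (fun w => \tr (peval (AA N w) G')) =
      expectc (P N) (fun w => (\sum_i x N w i ^+ m.+1)%:C).
    apply: expectc_ae.
    - by apply: bounded_crv_sum => i; exact: peval_bounded.
    - by apply: bounded_crv_real; exact: bS.
    apply: filterS (hG' N) => w; rewrite -/(AA N w) => ->.
    rewrite (rmorph_sum (real_complex R)) /=; apply: eq_bigr => i _.
    by rewrite mxE eqxx mulr1n (rmorphXn (real_complex R)).
  by rewrite expectc_real nc_real ler_norm.
(* m.+1 is the integer part of p *)
pose m := (Num.truncn p).-1.
have /andP[mp pm] := truncn_itv (le_trans ler01 p1).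
have m1 : m.+1 = Num.truncn p.
  rewrite /m prednK // -ltnS -(ltr_nat R); exact: le_lt_trans pm.
have [C [N0 hC]] := small m; have [C' [N0' hC']] := small m.+1.
have bP N i : bounded_rv (P N) (fun w => x N w i `^ p).
  have [mx1 [M hM]] := bounded_rvD (bx N i m.+1) (bx N i m.+2).
  split.
    apply: (measurableT_comp (measurable_powR p)).
    by have [] := sqnorm_bounded (bA N) G i.
  exists M; apply: filterS hM => w; apply: le_trans.
  rewrite ger0_norm ?powR_ge0 // (le_trans _ (ler_norm _)) //.
  by apply: powR_le_exprD; rewrite ?sqnorm_ge0 // m1 mp ltW.
have value N : Normc.normc (expectc (P N) (fun w =>
       N%:R^-1 * \tr (psd_powR (eps N w *m (eps N w)^t* ) p))) =
    N%:R^-1 * Rintegral (P N) setT (fun w => \sum_i x N w i `^ p).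
  have bSP : bounded_rv (P N) (fun w => \sum_i x N w i `^ p).
    by apply: bounded_rv_sum => i; exact: bP.
  have -> : expectc (P N) (fun w => N%:R^-1 * \tr (psd_powR (eps N w *m (eps N w)^t* ) p)) =
      expectc (P N) (fun w => (N%:R^-1 * \sum_i x N w i `^ p)%:C).
    apply: eq_expectc => w; rewrite epsE trace_psd_powR (rmorphM (real_complex R)) /=.
    by rewrite (fmorphV (real_complex R)) (rmorph_nat (real_complex R)).
  rewrite expectc_real nc_real RexpectZ //.
  rewrite ger0_norm // mulr_ge0 // ?invr_ge0 //; apply: Rintegral_ge0 => w _.
  by apply: sumr_ge0 => i _; exact: powR_ge0.
apply/cvgrPdist_le => e e0.
pose c := `|C| + `|C'|.
exists (maxn (maxn N0 N0') (Num.truncn ((c / e) ^+ 2)).+1) => // N.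
rewrite /mkset !geq_max => /andP[/andP[h0 h1] h2]; rewrite value sub0r normrN ger0_norm; last first.
  rewrite mulr_ge0 // ?invr_ge0 //; apply: Rintegral_ge0 => w _.
  by apply: sumr_ge0 => i _; exact: powR_ge0.
apply: le_trans (inv_sqrt_small (c := c) _ e0 h2); last by rewrite addr_ge0.
rewrite ler_wpM2l ?invr_ge0 //.
apply: (@le_trans _ _ (Rintegral (P N) setT (fun w =>
    \sum_i x N w i ^+ m.+1 + \sum_i x N w i ^+ m.+2))).
  apply: Rexpect_le; [by apply: bounded_rv_sum => i; exact: bP | exact: bounded_rvD |].
  move=> w; rewrite -big_split /=; apply: ler_sum => i _.
  by apply: powR_le_exprD; rewrite ?sqnorm_ge0 // m1 mp ltW.
rewrite RexpectD // mulrDl; apply: lerD.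
  apply: le_trans (hC N h0) _; rewrite ler_wpM2r ?ler_norm ?sqrtr_ge0 //.
by apply: le_trans (hC' N h1) _; rewrite ler_wpM2r ?ler_norm ?sqrtr_ge0.
Qed.
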